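(* For each $d\geq 2$ there exists a projective compactification $\widehat{\mathrm{MP}}_d$ of $\mathrm{MP}_d$ such that, for all $d\geq 2$ and all $n\geq 2$, the iteration map $\mathrm{MP}_d\to\mathrm{MP}_{d^n}$, $f\mapsto f^n$, extends c-analytically to a map $$\widehat{\mathrm{MP}}_d\to\widehat{\mathrm{MP}}_{d^n}.$$
   Context: $\mathrm{MP}_d=\mathrm{Poly}_d/\mathrm{Aut}(\mathbf{C})$ is the moduli space of complex polynomials of degree exactly $d$ modulo conjugation by affine transformations; it is a quotient of $\mathbf{C}^{d-1}$ (monic centered polynomials) by a finite group. $f^n$ denotes the $n$-th iterate of $f$. A projective compactification of $\mathrm{MP}_d$ is a projective variety containing $\mathrm{MP}_d$ as a dense open subset. A map between varieties is c-analytic if it is analytic away from the singularities (of the source) and continuous across them. *)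

(* Defs.v *)
From HB Require Import structures.
(* The notations of mpoly clash with those of mathcomp-analysis. *)
From mathcomp Require Import -(notations) mpoly.
From mathcomp Require Import all_boot all_order all_algebra.
From mathcomp Require Import generic_quotient complex.
From mathcomp Require Import all_classical all_reals all_analysis.

Set Implicit Arguments.
Unset Strict Implicit.
Unset Printing Implicit Defensive.

Import Order.TTheory GRing.Theory Num.Theory numFieldNormedType.Exports.

Local Open Scope classical_set_scope.
Local Open Scope ring_scope.
Local Open Scope quotient_scope.

(* The ground field is a numClosedFieldType K with the topology of its norm;
   the case of interest is K = R[i] for R : realType. *)

Definition Poly (K : numClosedFieldType) (d : nat) :=
  {f : {poly K} | size f == d.+1}.

Definition affine (K : numClosedFieldType) (a b : K) : {poly K} :=
  a *: 'X + b%:P.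

(* A \o f = g \o A for some affine automorphism A(z) = a z + b; here
   p \Po q is the composite z |-> p(q(z)). *)
Definition affine_conj (K : numClosedFieldType) (d : nat) : rel (Poly K d) :=
  fun f g => `[< exists a b : K, a != 0 /\
    affine a b \Po val f = val g \Po affine a b >].

Lemma affine_comp (K : numClosedFieldType) (a b a' b' : K) :
  affine a b \Po affine a' b' = affine (a * a') (a * b' + b).
Proof.
rewrite /affine comp_polyD comp_polyZ comp_polyX comp_polyC scalerDr scalerA.
by rewrite -addrA -[a *: b'%:P]mul_polyC -polyCM -polyCD.
Qed.

Lemma affine10 (K : numClosedFieldType) : affine 1 0 = 'X :> {poly K}.
Proof. by rewrite /affine scale1r addr0. Qed.

Lemma affine_conj_refl (K : numClosedFieldType) d :
  reflexive (@affine_conj K d).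
Proof.
move=> f; apply/asboolP; exists 1, 0; split; first exact: oner_neq0.
by rewrite affine10 comp_polyX comp_polyXr.
Qed.

Lemma affine_conj_sym (K : numClosedFieldType) d : symmetric (@affine_conj K d).
Proof.
suff H (f g : Poly K d) : affine_conj f g -> affine_conj g f.
  by move=> f g; apply/idP/idP; apply: H.
move=> /asboolP[a [b [a0 e]]]; apply/asboolP.
exists a^-1, (- (a^-1 * b)); split; first by rewrite invr_eq0.
set A := affine a b; set B := affine _ _.
have BA : B \Po A = 'X by rewrite affine_comp mulVf // addrN affine10.
have AB : A \Po B = 'X.
  by rewrite affine_comp mulfV // mulrN mulVKf // addNr affine10.
have := congr1 (fun p => (B \Po p) \Po B) e.
by rewrite /= comp_polyA BA comp_polyX -!comp_polyA AB comp_polyXr.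
Qed.

Lemma affine_conj_trans (K : numClosedFieldType) d :
  transitive (@affine_conj K d).
Proof.
move=> g f h /asboolP[a [b [a0 e]]] /asboolP[a' [b' [a'0 e']]]; apply/asboolP.
exists (a' * a), (a' * b + b'); split; first by rewrite mulf_neq0.
by rewrite -affine_comp -comp_polyA e comp_polyA e' comp_polyA.
Qed.

Canonical affine_conj_equiv (K : numClosedFieldType) d :=
  EquivRel (@affine_conj K d) (@affine_conj_refl K d) (@affine_conj_sym K d)
    (@affine_conj_trans K d).

Definition MP (K : numClosedFieldType) (d : nat) :=
  {eq_quot (affine_conj_equiv K d)}.

Definition poly_iter (K : numClosedFieldType) (n : nat) (f : {poly K}) :
  {poly K} := iter n (fun g => f \Po g) 'X.

Lemma size_poly_iter (K : numClosedFieldType) (d n : nat) (f : Poly K d) :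
  size (poly_iter n (val f)) == (d ^ n).+1.
Proof.
case: f => f /= /eqP sf; rewrite /poly_iter.
have [d0|d0] := posnP d.
  move: sf; rewrite d0 => /eqP /size_poly1P[c c0 ->].
  case: n => [|n]; first by rewrite /= size_polyX.
  by rewrite iterS comp_polyC exp0n // size_polyC c0.
elim: n => [|n IHn]; first by rewrite /= size_polyX.
move/eqP in IHn; set g := iter _ _ _ in IHn *.
have fg0 : f \Po g != 0.
  by rewrite comp_poly_eq0 ?IHn ?ltnS ?expn_gt0 ?d0 // -size_poly_gt0 sf.
rewrite iterS -/g -(prednK (_ : 0 < size (f \Po g))%N) ?size_poly_gt0 //.
by rewrite size_comp_poly sf IHn /= expnS.
Qed.

Definition Poly_iter (K : numClosedFieldType) (d n : nat) (f : Poly K d) :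
  Poly K (d ^ n) := exist _ (poly_iter n (val f)) (size_poly_iter n f).

Definition MP_iter (K : numClosedFieldType) (d n : nat) (m : MP K d) :
  MP K (d ^ n) := \pi_(MP K (d ^ n)) (Poly_iter n (repr m)).

Lemma MP_iterE (K : numClosedFieldType) (d n : nat) (f : Poly K d) :
  MP_iter n (\pi_(MP K d) f) = \pi_(MP K (d ^ n)) (Poly_iter n f).
Proof.
rewrite /MP_iter; apply/eqmodP => /=.
have /eqmodP /asboolP[a [b [a0 e]]] := reprK (\pi_(MP K d) f).
apply/asboolP; exists a, b; split=> //=.
rewrite /poly_iter; elim: n => [|n IHn]; first by rewrite /= comp_polyX comp_polyXr.
by rewrite !iterS comp_polyA e -!comp_polyA IHn.
Qed.

(* The monic centered polynomial X^d + a_{d-2} X^{d-2} + ... + a_0. *)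
Definition mc_poly (K : numClosedFieldType) (d : nat) (a : 'I_d.-1 -> K) :
  {poly K} := 'X^d + \sum_(i < d.-1) a i *: 'X^i.

Lemma size_mc_poly (K : numClosedFieldType) (d : nat) (a : 'I_d.-1 -> K) :
  size (mc_poly a) == d.+1.
Proof.
rewrite /mc_poly size_polyDl size_polyXn // ltnS.
apply: (leq_trans (size_sum _ _ _)); apply/bigmax_leqP => i _.
apply: (leq_trans (size_scale_leq _ _)); rewrite size_polyXn.
exact: leq_trans (ltn_ord i) (leq_pred d).
Qed.

Definition MP_mc (K : numClosedFieldType) (d : nat) (a : 'I_d.-1 -> K) : MP K d :=
  \pi_(MP K d) (exist _ (mc_poly a) (size_mc_poly a) : Poly K d).

(* For d >= 2 every class contains monic centered polynomials, and those form
   one orbit of the group of (d-1)-th roots of unity, acting on K^(d-1) by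
   a_i |-> u^(i-1) a_i.  MP_d is the affine variety K^(d-1) / mu_(d-1): its
   coordinate ring is the ring of invariant polynomials on K^(d-1), that is,
   of the functions on MP_d whose pull-back to K^(d-1) is polynomial. *)
Definition MP_coord_fun (K : numClosedFieldType) d (phi : MP K d -> K) :=
  exists p : mpoly d.-1 K, forall a, phi (MP_mc a) = meval a p.

Definition MP_closed (K : numClosedFieldType) d (A : set (MP K d)) :=
  exists S : set (MP K d -> K),
    (forall phi, S phi -> MP_coord_fun phi) /\
    A = [set m | forall phi, S phi -> phi m = 0].

(* phi is a regular function in a Zariski neighbourhood of m. *)
Definition MP_regular_at (K : numClosedFieldType) d (phi : MP K d -> K)
    (m : MP K d) :=
  exists f g : MP K d -> K, [/\ MP_coord_fun f, MP_coord_fun g, g m != 0 &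
    forall m', g m' != 0 -> phi m' = f m' / g m'].

(* The points of P^N are the lines of K^(N+1). *)
Definition projspace (K : numClosedFieldType) (N : nat) :=
  {L : {vspace 'rV[K]_N.+1} | \dim L == 1%N}.

HB.instance Definition _ (K : numClosedFieldType) N := Choice.on (projspace K N).

(* v is a vector of homogeneous coordinates of p. *)
Definition hcoord (K : numClosedFieldType) N (p : projspace K N) (v : 'rV[K]_N.+1) :=
  v != 0 /\ v \in val p.

Lemma hcoord_inj (K : numClosedFieldType) N (p q : projspace K N) v :
  hcoord p v -> hcoord q v -> p = q.
Proof.
move=> [v0 vp] [_ vq]; apply: val_inj.
have line (r : projspace K N) : v \in val r -> val r = <[v]>%VS.
  move=> vr; apply/esym/eqP; rewrite eqEdim -memvE vr /= dim_vline v0.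
  by rewrite (eqP (valP r)).
by rewrite (line p) // (line q).
Qed.

Lemma hcoord_ex (K : numClosedFieldType) N (v : 'rV[K]_N.+1) :
  v != 0 -> exists p, hcoord p v.
Proof.
move=> v0; have d1 : \dim <[v]>%VS == 1%N by rewrite dim_vline v0.
by exists (exist _ <[v]>%VS d1); split=> //=; exact: memv_line.
Qed.

(* The classical topology of P^N: the quotient topology of K^(N+1) \ {0}. *)
Definition hcone (K : numClosedFieldType) N (A : set (projspace K N)) :
  set 'rV[K]_N.+1 := [set v | exists2 p, A p & hcoord p v].

Definition proj_open (K : numClosedFieldType) N : set_system (projspace K N) :=
  [set A | open (hcone A)].

Lemma proj_openT (K : numClosedFieldType) N : @proj_open K N setT.
Proof.
rewrite /proj_open /= (_ : hcone _ = ~` [set 0]).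
  by apply: closed_openC; apply: accessible_closed_set1; apply: hausdorff_accessible;
  exact: norm_hausdorff.
apply/seteqP; split=> v /=; first by move=> [p _ [/eqP]].
by move=> /eqP /hcoord_ex[p pv]; exists p.
Qed.

Lemma proj_openI (K : numClosedFieldType) N : setI_closed (@proj_open K N).
Proof.
move=> A B oA oB; rewrite /proj_open /= (_ : hcone _ = hcone A `&` hcone B).
  exact: openI.
apply/seteqP; split=> v /=.
  by move=> [p [Ap Bp] pv]; split; exists p.
by move=> [[p Ap pv] [q Bq qv]]; exists p => //; split=> //; rewrite (hcoord_inj pv qv).
Qed.

Lemma proj_open_bigU (K : numClosedFieldType) N (I : Type)
    (f : I -> set (projspace K N)) :
  (forall i, proj_open (f i)) -> proj_open (\bigcup_i f i).
Proof.
move=> of_; rewrite /proj_open /= (_ : hcone _ = \bigcup_i hcone (f i)).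
  by apply: bigcup_open => i _; exact: of_.
apply/seteqP; split=> v /=.
  by move=> [p [i _ fp] pv]; exists i => //; exists p.
by move=> [i _ [p fp pv]]; exists p => //; exists i.
Qed.

HB.instance Definition _ (K : numClosedFieldType) N :=
  isOpenTopological.Build (projspace K N) (@proj_openT K N) (@proj_openI K N)
    (@proj_open_bigU K N).

Definition hpoly (K : numClosedFieldType) n (k : nat) (F : mpoly n K) : bool :=
  F \is ishomog1 k (@mdeg n).

Definition rv_eval (K : numClosedFieldType) n (F : mpoly n K) (v : 'rV[K]_n) : K :=
  meval (fun i => v ord0 i) F.

Definition vanish_on (K : numClosedFieldType) N (A : set (projspace K N))
    (F : mpoly N.+1 K) :=
  forall p v, A p -> hcoord p v -> rv_eval F v = 0.

Definition zclosed (K : numClosedFieldType) N (A : set (projspace K N)) :=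
  exists S : set (mpoly N.+1 K),
    (forall F, S F -> exists k, hpoly k F) /\
    A = [set p | forall F v, S F -> hcoord p v -> rv_eval F v = 0].

Definition zirreducible (K : numClosedFieldType) N (A : set (projspace K N)) :=
  A !=set0 /\ forall Z1 Z2, zclosed Z1 -> zclosed Z2 ->
    A `<=` Z1 `|` Z2 -> A `<=` Z1 \/ A `<=` Z2.

Definition projective_variety (K : numClosedFieldType) N (X : set (projspace K N)) :=
  zclosed X /\ zirreducible X.

(* In a Zariski neighbourhood of p in A, phi is a quotient of two homogeneous
   polynomials of the same degree. *)
Definition regular_at (K : numClosedFieldType) N (A : set (projspace K N))
    (phi : projspace K N -> K) (p : projspace K N) :=
  exists (k : nat) (F G : mpoly N.+1 K), [/\ hpoly k F, hpoly k G,
    forall v, hcoord p v -> rv_eval G v != 0 &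
    forall q v, A q -> hcoord q v -> rv_eval G v != 0 ->
      phi q = rv_eval F v / rv_eval G v].

(* iota identifies MP_d, as a space with a Zariski topology and a sheaf of
   regular functions, with a Zariski open subset of X. *)
Definition open_immersion (K : numClosedFieldType) d N (X : set (projspace K N))
    (iota : MP K d -> projspace K N) :=
  [/\ injective iota,
      exists Z, zclosed Z /\ range iota = X `\` Z,
      forall A, MP_closed A <-> exists Z, zclosed Z /\ A = iota @^-1` Z &
      forall m (phi : projspace K N -> K),
        regular_at (range iota) phi (iota m) <-> MP_regular_at (phi \o iota) m].

Definition zdense (K : numClosedFieldType) N (A X : set (projspace K N)) :=
  forall Z, zclosed Z -> A `<=` Z -> X `<=` Z.

Definition projective_compactification (K : numClosedFieldType) d N
    (X : set (projspace K N)) (iota : MP K d -> projspace K N) :=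
  [/\ projective_variety X, open_immersion X iota & zdense (range iota) X].

(* A strict chain of r + 1 irreducible closed subsets of X. *)
Definition zchain (K : numClosedFieldType) N (X : set (projspace K N)) (r : nat) :=
  exists s : nat -> set (projspace K N),
    (forall i, (i <= r)%N -> [/\ zclosed (s i), zirreducible (s i) & s i `<=` X]) /\
    (forall i, (i < r)%N -> s i `<` s i.+1).

Definition has_zdim (K : numClosedFieldType) N (X : set (projspace K N)) (r : nat) :=
  zchain X r /\ ~ zchain X r.+1.

(* G generates the homogeneous ideal of X. *)
Definition generates_ideal (K : numClosedFieldType) N (X : set (projspace K N)) k
    (G : 'I_k -> mpoly N.+1 K) :=
  (forall i, (exists e, hpoly e (G i)) /\ vanish_on X (G i)) /\
  (forall F, (exists e, hpoly e F) -> vanish_on X F ->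
    exists H : 'I_k -> mpoly N.+1 K, F = \sum_(i < k) H i * G i).

(* Jacobian criterion: the rank of the Jacobian matrix at p of generators of
   the homogeneous ideal of X is N - dim X. *)
Definition nonsingular_at (K : numClosedFieldType) N (X : set (projspace K N))
    (p : projspace K N) :=
  exists (r k : nat) (G : 'I_k -> mpoly N.+1 K),
    [/\ has_zdim X r, generates_ideal X G &
        forall v, hcoord p v ->
          (\rank (\matrix_(i < k, j < N.+1) rv_eval (mderiv j (G i)) v) + r = N)%N].

(* f is, near p, the restriction to X of an analytic map between open subsets
   of the ambient projective spaces, written in homogeneous coordinates.
   Differentiability is over the field K, i.e. complex differentiability when
   K = R[i]: on an open set this is analyticity. *)
Definition analytic_at (K : numClosedFieldType) N M (X : set (projspace K N))
    (f : projspace K N -> projspace K M) (p : projspace K N) :=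
  exists (U : set 'rV[K]_N.+1) (Phi : 'rV[K]_N.+1 -> 'rV[K]_M.+1),
    [/\ open U, exists2 v, U v & hcoord p v,
        forall v, U v -> differentiable Phi v &
        forall q v, X q -> U v -> hcoord q v -> hcoord (f q) (Phi v)].

Definition c_analytic (K : numClosedFieldType) N M (X : set (projspace K N))
    (f : projspace K N -> projspace K M) :=
  {within X, continuous f} /\
  forall p, X p -> nonsingular_at X p -> analytic_at X f p.

(* Main.v *)
Require Import Defs.
From mathcomp Require Import -(notations) mpoly.
From mathcomp Require Import all_boot all_order all_algebra.
From mathcomp Require Import generic_quotient complex zify ring.
From mathcomp Require Import all_classical all_reals all_analysis.
From mathcomp Require cyclic separable cyclotomic.

(* Conjugating by z |-> u z identifies MP_d with the chart {s <> 0} of the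
   weighted projective space X_d with coordinates s of weight d - 1 and a_i of
   weight d - i (0 <= i <= d - 2), where a point with s = 1 is the class of
   z^d + sum a_i z^i.  All the monomials of a suitable weighted degree m embed
   X_d in a projective space.  Its image is cut out by binomials, because a
   character of a subgroup of Z^n with values in the divisible group K^*
   extends to Z^n.

   If z has weight 1, then f(z) = z^d + sum a_i z^i is homogeneous of degree d,
   and in f(g(z)) with g of degree e the term a_i g^i falls short of g^d by
   (e - 1)(d - i).  Powers of s make up for this, so the coefficients of f^n
   are weighted homogeneous polynomials in (s, a).  At s = 0 the homogenized
   iterate is the power f^(d^(n-1)), which is z^(d^n) only if all a_i are 0.
   Hence iteration extends to a morphism X_d -> X_(d^n), given by forms of the
   same degree in the ambient projective coordinates. *)

Set Implicit Arguments.
Unset Strict Implicit.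
Unset Printing Implicit Defensive.

Import Order.TTheory GRing.Theory Num.Theory numFieldNormedType.Exports.

Local Open Scope classical_set_scope.
Local Open Scope ring_scope.

Lemma hcoord_exists (K : numClosedFieldType) N (p : projspace K N) :
  exists v, hcoord p v.
Proof.
exists (vpick (val p)); split; last exact: memv_pick.
by rewrite vpick0 -dimv_eq0 (eqP (valP p)).
Qed.

(** * Monomial maps of tori and extension of characters *)

Section Characters.
Variable K : numClosedFieldType.
Implicit Types (a b c : nat).

(** The homomorphism of tori whose components are the Laurent monomials with exponents in the rows
    of [M]; composition becomes the matrix product. *)
Definition torus_pow a b (M : 'M[int]_(a, b)) (y : 'I_b -> K) : 'I_a -> K :=
  fun j => \prod_i y i ^ M j i.

Lemma expfz_sum (I : Type) (r : seq I) (P : pred I) (F : I -> int) (x : K) :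
  x != 0 -> x ^ (\sum_(i <- r | P i) F i) = \prod_(i <- r | P i) x ^ F i.
Proof.
move=> x0; apply: (big_morph (fun z => x ^ z)); last exact: expr0z.
by move=> m n; rewrite expfzDr.
Qed.

Lemma expfz_prod (I : Type) (r : seq I) (P : pred I) (F : I -> K) (z : int) :
  (\prod_(i <- r | P i) F i) ^ z = \prod_(i <- r | P i) F i ^ z.
Proof.
apply: (big_morph (fun x : K => x ^ z)); last exact: exp1rz.
by move=> x y; rewrite expfzMl.
Qed.

Lemma torus_pow_neq0 a b (M : 'M[int]_(a, b)) y :
  (forall i, y i != 0) -> forall j, torus_pow M y j != 0.
Proof. by move=> y0 j; apply/prodf_neq0 => i _; rewrite expfz_neq0. Qed.

Lemma torus_powM a b c (M : 'M[int]_(a, b)) (N : 'M[int]_(b, c)) y :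
  (forall i, y i != 0) ->
  torus_pow (M *m N) y =1 torus_pow M (torus_pow N y).
Proof.
move=> y0 j; rewrite /torus_pow.
under eq_bigr => i _ do rewrite mxE (expfz_sum _ _ _ (y0 i)).
rewrite exchange_big; apply: eq_bigr => k _ /=; rewrite expfz_prod.
by apply: eq_bigr => i _; rewrite exprz_exp mulrC.
Qed.

Lemma torus_pow1 a (y : 'I_a -> K) : torus_pow 1%:M y =1 y.
Proof.
move=> j; rewrite /torus_pow (bigD1 j) //= mxE eqxx expr1z big1 ?mulr1 // => i.
by rewrite mxE eq_sym => /negPf ->; rewrite expr0z.
Qed.

Lemma eq_torus_pow a b (M : 'M[int]_(a, b)) y y' :
  y =1 y' -> torus_pow M y =1 torus_pow M y'.
Proof. by move=> e j; apply: eq_bigr => i _; rewrite e. Qed.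

(** The multiplicative group of an algebraically closed field is divisible; a negative exponent is
    handled by a root of the inverse. *)
Lemma exprz_root_ex (x : K) (z : int) :
  x != 0 -> z != 0 -> exists2 r : K, r != 0 & r ^ z = x.
Proof.
have root_ex (u : K) k : u != 0 -> exists2 r : K, r != 0 & r ^+ k.+1 = u.
  move=> u0; exists (k.+1.-root u); last exact: rootCK.
  by rewrite rootC_eq0.
case: z => [[//|k]|k] x0 _; first exact: root_ex.
have [r r0 e] := root_ex x^-1 k (invr_neq0 x0).
by exists r => //; rewrite NegzE -exprnN e invrK.
Qed.

(** Splitting integer exponents into natural ones turns a relation between Laurent monomials into an
    equality of two monomials. As [Negz k] is -(k + 1), its negative part is [k.+1]. *)
Definition posz_part (z : int) : nat := if z is Posz k then k else 0%N.
Definition negz_part (z : int) : nat := if z is Negz k then k.+1 else 0%N.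

Lemma intz_parts (z : int) : z = (posz_part z)%:Z - (negz_part z)%:Z.
Proof. by case: z => k; rewrite /= ?subr0 ?sub0r ?NegzE. Qed.

Lemma exprz_parts (x : K) (z : int) : x ^ z = x ^+ posz_part z / x ^+ negz_part z.
Proof.
by case: z => k; rewrite ?NegzE -?exprnN -?exprnP expr0 ?mul1r ?divr1.
Qed.

(* A homomorphism into the divisible group K^* extends from the subgroup of Z^b
   spanned by the rows of A to Z^b; Smith normal form reduces this to the
   diagonal case, where one extracts roots. *)
Lemma torus_pow_solve a b (A : 'M[int]_(a, b)) (c : 'I_a -> K) :
  (forall j, c j != 0) ->
  (forall mu : 'rV[int]_a, mu *m A = 0 -> \prod_j c j ^ mu 0 j = 1) ->
  exists2 y : 'I_b -> K, (forall i, y i != 0) & torus_pow A y =1 c.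
Proof.
move=> c0 relc.
have [L Lu [R Ru [d _ eA]]] := int_Smith_normal_form A.
set D := (\matrix_(i, j) _) in eA.
(* With A = L D R and L, R invertible over the integers, the system for A and [c] becomes the
   diagonal system for D and [c']. *)
pose c' := torus_pow (invmx L) c.
have c'0 j : c' j != 0 by exact: torus_pow_neq0.
(* A zero row of D makes the corresponding row of the inverse of L a relation between the rows of A,
   to which [relc] applies. *)
have c'1 j : row j D = 0 -> c' j = 1.
  move=> rj; rewrite /c' /torus_pow -[RHS](relc (row j (invmx L))).
    by apply: eq_bigr => k _; rewrite mxE.
  by rewrite eA !mulmxA -row_mul mulVmx // -row_mul mul1mx rj mul0mx.
(* The diagonal system is solved one coordinate at a time; a coordinate without a row, or with
   diagonal entry 0, is set to 1. *)
have /fin_all_exists[z zP] : forall i : 'I_b, exists r : K, r != 0 /\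
    forall j : 'I_a, i = j :> nat -> r ^ d`_i = c' j.
  move=> i; have [lt_ia|le_ai] := ltnP i a; last first.
    by exists 1; split=> [|j e]; [exact: oner_neq0 | have := ltn_ord j; lia].
  pose j := Ordinal lt_ia.
  suff [r r0 e] : exists2 r : K, r != 0 & r ^ d`_i = c' j.
    exists r; split=> // k ek; rewrite e; congr (c' _); exact: val_inj.
  have [di0|] := eqVneq d`_i 0; last exact: exprz_root_ex.
  exists 1; rewrite ?oner_neq0 // exp1rz c'1 //; apply/rowP => k.
  rewrite !mxE; case: eqP => //=; rewrite ?mulr0n.
have z0 i : z i != 0 by case: (zP i).
have Dz : torus_pow D z =1 c'.
  move=> j; have [lt_jb|le_bj] := ltnP j b; last first.
    rewrite c'1; last first.
      apply/rowP => k; rewrite !mxE; case: eqP => // e.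
      by have := ltn_ord k; lia.
    rewrite /torus_pow big1 // => k _; rewrite !mxE; case: eqP => // e.
    by have := ltn_ord k; lia.
  pose i := Ordinal lt_jb.
  rewrite /torus_pow (bigD1 i) //= mxE eqxx mulr1n big1 ?mulr1.
    by case: (zP i) => _ /(_ j erefl) /=.
  move=> k ki; rewrite mxE; case: eqP => [e|_]; last by rewrite mulr0n expr0z.
  by case/eqP: ki; apply: val_inj.
exists (torus_pow (invmx R) z) => [|j]; first exact: torus_pow_neq0.
have Rz0 i : torus_pow (invmx R) z i != 0 by exact: torus_pow_neq0.
rewrite eA torus_powM //.
have Rz : torus_pow R (torus_pow (invmx R) z) =1 z.
  by move=> i; rewrite -torus_powM // mulmxV // torus_pow1.
rewrite (eq_torus_pow _ Rz) torus_powM // (eq_torus_pow _ Dz) /c'.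
by rewrite -torus_powM // mulmxV // torus_pow1.
Qed.

End Characters.

(** * Weighted homogeneous polynomial functions *)

Section WeightedMonomials.
Variables (K : numClosedFieldType) (n : nat) (w : 'I_n -> nat).
Implicit Types (y : 'I_n -> K) (alpha beta : 'I_n -> nat).

Definition weight alpha : nat := (\sum_i w i * alpha i)%N.

Definition wmon y alpha : K := \prod_i y i ^+ alpha i.

Lemma eq_weight alpha beta : alpha =1 beta -> weight alpha = weight beta.
Proof. by move=> e; apply: eq_bigr => i _; rewrite e. Qed.

Lemma eq_wmon y alpha beta : alpha =1 beta -> wmon y alpha = wmon y beta.
Proof. by move=> e; apply: eq_bigr => i _; rewrite e. Qed.

Lemma weightD alpha beta :
  weight (fun i => alpha i + beta i)%N = (weight alpha + weight beta)%N.
Proof. by rewrite -big_split; apply: eq_bigr => i _; rewrite mulnDr. Qed.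

Lemma weightMn k alpha : weight (fun i => k * alpha i)%N = (k * weight alpha)%N.
Proof. by rewrite /weight big_distrr; apply: eq_bigr => i _; rewrite mulnCA. Qed.

Lemma wmonD y alpha beta :
  wmon y (fun i => alpha i + beta i)%N = wmon y alpha * wmon y beta.
Proof. by rewrite -big_split; apply: eq_bigr => i _; rewrite exprD. Qed.

Lemma wmonMn y k alpha : wmon y (fun i => k * alpha i)%N = wmon y alpha ^+ k.
Proof. by rewrite -prodrXl; apply: eq_bigr => i _; rewrite mulnC exprM. Qed.

Lemma wmon_scale (c : K) y alpha :
  wmon (fun i => c ^+ w i * y i) alpha = c ^+ weight alpha * wmon y alpha.
Proof.
rewrite /weight -prodrXr -big_split; apply: eq_bigr => i _.
by rewrite exprMn exprM.
Qed.

Definition pure (i : 'I_n) (k : nat) : 'I_n -> nat :=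
  fun i' => if i' == i then k else 0%N.

Lemma weight_pure i k : weight (pure i k) = (w i * k)%N.
Proof.
rewrite /weight (bigD1 i) //= /pure eqxx big1 ?addn0 // => j /negPf ->.
by rewrite muln0.
Qed.

Lemma wmon_pure y i k : wmon y (pure i k) = y i ^+ k.
Proof.
rewrite /wmon (bigD1 i) //= /pure eqxx big1 ?mulr1 // => j /negPf ->.
by rewrite expr0.
Qed.

(** Weighted forms are taken as functions, closed under pointwise equality, so that the coefficients
    of a polynomial depending on [y] qualify without being written as multivariate polynomials. *)
Inductive wform : nat -> (('I_n -> K) -> K) -> Prop :=
| WformMon (c : K) alpha : wform (weight alpha) (fun y => c * wmon y alpha)
| Wform0 e : wform e (fun=> 0)
| WformD e P Q : wform e P -> wform e Q -> wform e (fun y => P y + Q y)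
| WformE e P Q : P =1 Q -> wform e P -> wform e Q.

Lemma wformMmon e Q (c : K) alpha : wform e Q ->
  wform (weight alpha + e) (fun y => c * wmon y alpha * Q y).
Proof.
elim=> {e Q} [c' beta|e|e P Q _ hP _ hQ|e P Q eq _ hP].
- rewrite -weightD; apply: WformE (WformMon (c * c') _) => y.
  by rewrite wmonD; ring.
- by apply: WformE (Wform0 _) => y; rewrite mulr0.
- by apply: WformE (WformD hP hQ) => y; rewrite mulrDr.
- by apply: WformE hP => y; rewrite eq.
Qed.

Lemma wformM e e' P Q : wform e P -> wform e' Q ->
  wform (e + e') (fun y => P y * Q y).
Proof.
move=> hP hQ.
elim: hP => {e P} [c alpha|e|e P P' _ hP _ hP'|e P P' eq _ hP].
- exact: wformMmon.
- by apply: WformE (Wform0 _) => y; rewrite mul0r.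
- by apply: WformE (WformD hP hP') => y; rewrite mulrDl.
- by apply: WformE hP => y; rewrite eq.
Qed.

Lemma wform_cst (c : K) : wform 0 (fun=> c).
Proof.
have w0 : weight (fun=> 0%N) = 0%N by apply: big1 => i _; rewrite muln0.
rewrite -w0; apply: WformE (WformMon c _) => y.
by rewrite /wmon big1 ?mulr1 // => i _; rewrite expr0.
Qed.

Lemma wform_var i : wform (w i) (fun y => y i).
Proof.
rewrite -[w i]muln1 -weight_pure; apply: WformE (WformMon 1 _) => y.
by rewrite wmon_pure mul1r expr1.
Qed.

Lemma wformX e P k : wform e P -> wform (k * e) (fun y => P y ^+ k).
Proof.
move=> hP; elim: k => [|k IHk]; first exact: wform_cst.
by rewrite mulSn; apply: WformE (wformM hP IHk) => y; rewrite exprS.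
Qed.

Lemma wform_sum (I : Type) (r : seq I) (C : pred I) e (P : I -> ('I_n -> K) -> K) :
  (forall i, C i -> wform e (P i)) ->
  wform e (fun y => \sum_(i <- r | C i) P i y).
Proof.
move=> hP; elim: r => [|i r IHr].
  by apply: WformE (Wform0 _) => y; rewrite big_nil.
have [Ci|nCi] := boolP (C i).
  by apply: WformE (WformD (hP _ Ci) IHr) => y; rewrite big_cons Ci.
by apply: WformE IHr => y; rewrite big_cons (negPf nCi).
Qed.

Lemma wform_prod (I : Type) (r : seq I) (e : I -> nat) (P : I -> ('I_n -> K) -> K) :
  (forall i, wform (e i) (P i)) ->
  wform (\sum_(i <- r) e i)%N (fun y => \prod_(i <- r) P i y).
Proof.
move=> hP; elim: r => [|i r IHr].
  by rewrite big_nil; apply: WformE (wform_cst 1) => y; rewrite big_nil.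
by rewrite big_cons; apply: WformE (wformM (hP i) IHr) => y; rewrite big_cons.
Qed.

End WeightedMonomials.

(** * Weighted projective space and its Veronese embedding *)

Section Veronese.
Variables (K : numClosedFieldType) (n : nat) (w : 'I_n -> nat) (m : nat).

(** Bounding the exponents by m makes the set finite; for positive weights no exponent of weight m
    is lost. *)
Definition wexpos : seq {ffun 'I_n -> 'I_m.+1} :=
  enum [pred alpha : {ffun 'I_n -> 'I_m.+1} | weight w (fun i => alpha i) == m].

Definition wdim : nat := (size wexpos).-1.

Definition wexpo (j : 'I_wdim.+1) : 'I_n -> nat :=
  fun i => nth [ffun=> ord0] wexpos j i.

Definition veronese (y : 'I_n -> K) : 'rV[K]_wdim.+1 := \row_j wmon y (wexpo j).

(* The image of the weighted projective space with weights w. *)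
Definition wps : set (projspace K wdim) :=
  [set p | exists y, hcoord p (veronese y)].

End Veronese.

Arguments wps {K n} w m _.

Section VeroneseTheory.
Variables (K : numClosedFieldType) (n : nat) (w : 'I_n -> nat) (L : nat).
Hypotheses (n_gt0 : (0 < n)%N) (L_gt0 : (0 < L)%N).
Hypotheses (w_gt0 : forall i, (0 < w i)%N) (w_dvd : forall i, (w i %| L)%N).

Let m := (L * n)%N.
Let N := wdim w m.
Implicit Types (y : 'I_n -> K) (alpha beta : 'I_n -> nat).

Let m_gt0 : (0 < m)%N. Proof. by rewrite muln_gt0 L_gt0. Qed.

Let w_dvdm i : (w i %| m)%N. Proof. exact: dvdn_mulr. Qed.

Lemma leq_weight alpha i : (alpha i <= weight w alpha)%N.
Proof.
rewrite /weight (bigD1 i) //=; apply: leq_trans (leq_addr _ _).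
by rewrite leq_pmull.
Qed.

Lemma mem_wexpos alpha : weight w alpha = m ->
  exists2 a : {ffun 'I_n -> 'I_m.+1}, a \in wexpos w m &
    forall i, alpha i = a i :> nat.
Proof.
move=> wa; have le i : (alpha i < m.+1)%N by rewrite ltnS -wa leq_weight.
exists [ffun i => Ordinal (le i)]; last by move=> i; rewrite ffunE.
rewrite mem_enum inE; apply/eqP; rewrite -[RHS]wa; apply: eq_weight => i.
by rewrite ffunE.
Qed.

Lemma size_wexpos : (0 < size (wexpos w m))%N.
Proof.
have [|a + _] := @mem_wexpos (pure (Ordinal n_gt0) (m %/ w (Ordinal n_gt0))).
  by rewrite weight_pure mulnC divnK.
by case: wexpos.
Qed.

Lemma wexpo_weight (j : 'I_N.+1) : weight w (wexpo j) = m.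
Proof.
have : nth [ffun=> ord0] (wexpos w m) j \in wexpos w m.
  by apply: mem_nth; rewrite -[X in (_ < X)%N](prednK size_wexpos) ltn_ord.
by rewrite mem_enum inE => /eqP.
Qed.

Lemma wexpo_surj alpha : weight w alpha = m -> exists j : 'I_N.+1, wexpo j =1 alpha.
Proof.
case/mem_wexpos => a a_in ea.
have lt : (index a (wexpos w m) < N.+1)%N.
  by rewrite /N /wdim prednK ?size_wexpos // index_mem.
by exists (Ordinal lt) => i; rewrite ea /wexpo /= nth_index.
Qed.

Lemma pure_index : exists p : 'I_n -> 'I_N.+1,
  forall i, wexpo (p i) =1 pure i (m %/ w i).
Proof.
apply: (@fin_all_exists _ _ (fun i j => wexpo j =1 pure i (m %/ w i))) => i.
by apply: wexpo_surj; rewrite weight_pure mulnC divnK.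
Qed.

(** Pigeonhole: if the weight is L t with t > n, some variable alone contributes at least L, and a
    power of it of weight exactly L can be split off. Descent stops at t = n, which is why m = L n
    is chosen. *)
Lemma sub_weight t alpha : (n <= t)%N -> weight w alpha = (L * t)%N ->
  exists2 beta, (forall i, (beta i <= alpha i)%N) & weight w beta = m.
Proof.
elim: t alpha => [|t IHt] alpha; first by have := n_gt0; lia.
rewrite leq_eqVlt => /orP[/eqP e wa|lt wa]; first by exists alpha; rewrite // wa -e.
have [i Li] : exists i, (L <= w i * alpha i)%N.
  apply: contrapT => /forallNP no; suff : (weight w alpha < L * n.+1)%N.
    by rewrite wa ltn_pmul2l // ltnNge lt.
  apply: (@leq_ltn_trans (\sum_(i < n) L)%N).
    by apply: leq_sum => i _; apply: ltnW; rewrite ltnNge; apply/negP/no.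
  by rewrite sum_nat_const card_ord mulnC ltn_pmul2l.
set u := (L %/ w i)%N.
have wu : (w i * u = L)%N by rewrite mulnC divnK.
have ua : (u <= alpha i)%N by rewrite -(leq_pmul2l (w_gt0 i)) wu.
pose al' i' := (alpha i' - pure i u i')%N.
have eal i' : alpha i' = (pure i u i' + al' i')%N.
  by rewrite /al' /pure; case: eqP => [->|]; lia.
have [|beta bal wb] := IHt al' lt.
  by move: wa; rewrite (eq_weight _ eal) weightD weight_pure wu; lia.
by exists beta => // i'; rewrite eal (leq_trans (bal i')) // leq_addl.
Qed.

(* The Veronese ring of degree m is generated in degree 1. *)
Lemma weight_decomp k alpha : weight w alpha = (k * m)%N ->
  exists2 delta : 'I_N.+1 -> nat, (\sum_j delta j)%N = k &
    forall i, alpha i = (\sum_j delta j * wexpo j i)%N.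
Proof.
elim: k alpha => [|k IHk] alpha wa.
  exists (fun=> 0%N) => [|i]; first by rewrite big1.
  by rewrite big1 //; apply/eqP; rewrite -leqn0 -[X in (_ <= X)%N]wa leq_weight.
have [||beta bal wb] := @sub_weight (k.+1 * n) alpha.
- by rewrite leq_pmull.
- by rewrite wa /m; lia.
have ea i : alpha i = (beta i + (alpha i - beta i))%N by have := bal i; lia.
have [|delta sd ed] := IHk (fun i => alpha i - beta i)%N.
  by move: wa; rewrite (eq_weight _ ea) weightD wb; lia.
have [j ej] := wexpo_surj wb.
exists (fun j' => (j' == j) + delta j')%N => [|i].
  rewrite big_split /= sd -[k.+1]add1n; congr addn.
  by rewrite (bigD1 j) //= eqxx big1 // => j' /negPf ->.
under eq_bigr => j' _ do rewrite mulnDl.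
rewrite big_split /= -ed {1}ea; congr addn.
by rewrite (bigD1 j) //= eqxx big1 ?ej; [lia | move=> j' /negPf ->].
Qed.

Lemma veroneseE y j : veronese w m y ord0 j = wmon y (wexpo j).
Proof. by rewrite mxE. Qed.

Lemma wmon_veronese y (delta : 'I_N.+1 -> nat) :
  wmon y (fun i => \sum_j delta j * wexpo j i)%N =
  \prod_j veronese w m y ord0 j ^+ delta j.
Proof.
rewrite /wmon; under eq_bigr => i _ do rewrite -prodrXr.
rewrite exchange_big; apply: eq_bigr => j _ /=.
by rewrite veroneseE -wmonMn.
Qed.

Lemma hpoly_mon (delta : 'I_N.+1 -> nat) k : (\sum_j delta j)%N = k ->
  hpoly k (mpolyX K (Multinom [tuple delta j | j < N.+1])).
Proof.
move=> <-; rewrite /hpoly dhomogX; apply/eqP; apply: etrans (mdegE _) _.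
by apply: eq_bigr => j _; rewrite mnmE.
Qed.

Lemma rv_eval_mon (delta : 'I_N.+1 -> nat) (v : 'rV[K]_N.+1) :
  rv_eval (mpolyX K (Multinom [tuple delta j | j < N.+1])) v =
  \prod_j v ord0 j ^+ delta j.
Proof. by rewrite /rv_eval mevalX; apply: eq_bigr => j _; rewrite mnmE. Qed.

(** By [weight_decomp] a monomial of weight k m is a product of k Veronese coordinates. *)
Lemma wform_hpoly e P k : wform w e P -> e = (k * m)%N ->
  exists2 F : mpoly N.+1 K, hpoly k F & forall y, rv_eval F (veronese w m y) = P y.
Proof.
elim=> {e P} [c alpha wa|e _|e P Q _ hP _ hQ ek|e P Q eq _ hP ek].
- have [delta sd ed] := weight_decomp wa.
  exists (c *: mpolyX K (Multinom [tuple delta j | j < N.+1])).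
    by apply: dhomogZ; exact: hpoly_mon.
  move=> y; rewrite /rv_eval mevalZ; congr (_ * _).
  by rewrite -/(rv_eval _ _) rv_eval_mon -wmon_veronese (eq_wmon _ ed).
- by exists 0 => [|y]; [exact: dhomog0 | rewrite /rv_eval meval0].
- have [F hF eF] := hP ek; have [G hG eG] := hQ ek.
  exists (F + G) => [|y]; first exact: (rpredD hF hG).
  by rewrite /rv_eval mevalD -[P y]eF -[Q y]eG.
- by have [F hF eF] := hP ek; exists F => // y; rewrite -eq.
Qed.

Lemma veronese_neq0 y : (veronese w m y != 0) = [exists i, y i != 0].
Proof.
apply/idP/existsP => [|[i yi0]].
  apply: contraPP => /forallNP y0; apply/negP; rewrite negbK; apply/eqP/rowP => j.
  rewrite veroneseE mxE /wmon; have [i wi] : exists i, (0 < wexpo j i)%N.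
    apply: contrapT => /forallNP no; have := m_gt0.
    rewrite -(wexpo_weight j) /weight big1 // => i _.
    by have /negP := no i; rewrite -eqn0Ngt => /eqP ->; rewrite muln0.
  have /negP := y0 i; rewrite negbK => /eqP yi.
  by rewrite (bigD1 i) //= yi expr0n eqn0Ngt wi mul0r.
have [p pP] := pure_index; apply/eqP => /rowP /(_ (p i)).
rewrite veroneseE mxE (eq_wmon _ (pP i)) wmon_pure => /eqP.
by rewrite expf_eq0 (negPf yi0) andbF.
Qed.

Lemma veronese_scale (c : K) y :
  veronese w m (fun i => c ^+ w i * y i) = c ^+ m *: veronese w m y.
Proof. by apply/rowP => j; rewrite !mxE wmon_scale wexpo_weight. Qed.

(** Any scalar c is absorbed into the weighted variables by rescaling them with an m-th root of
    c. *)
Lemma wps_hcoord p v : wps w m p -> hcoord p v -> exists y, v = veronese w m y.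
Proof.
move=> [y [y0 yp]] [v0 vp].
have /vlineP[c ec] : v \in <[veronese w m y]>%VS.
  suff -> : <[veronese w m y]>%VS = val p by [].
  by apply/eqP; rewrite eqEdim -memvE yp dim_vline y0 (eqP (valP p)).
exists (fun i => (m.-root c) ^+ w i * y i); rewrite veronese_scale ec.
by rewrite rootCK.
Qed.

Lemma weight_comb (mu : 'I_N.+1 -> nat) :
  weight w (fun i => \sum_j mu j * wexpo j i)%N = ((\sum_j mu j) * m)%N.
Proof.
rewrite /weight; under eq_bigr => i _ do rewrite big_distrr /=.
rewrite exchange_big /= big_distrl /=; apply: eq_bigr => j _.
apply: etrans (congr1 (muln (mu j)) (wexpo_weight j)); rewrite /weight big_distrr /=.
by apply: eq_bigr => i _; rewrite mulnCA.
Qed.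

(** The binomial equations of the image: two ambient monomials that pull back to the same monomial
    in [y] take the same value. *)
Definition toric (v : 'rV[K]_N.+1) :=
  forall mu nu : 'I_N.+1 -> nat,
    (forall i, \sum_j mu j * wexpo j i = \sum_j nu j * wexpo j i)%N ->
    \prod_j v ord0 j ^+ mu j = \prod_j v ord0 j ^+ nu j.

(** m times the exponent of coordinate j is a natural combination of the exponents of the pure
    powers. Hence the pure coordinates decide which coordinates of [v] vanish. *)
Lemma toric_pure p v j : (forall i, wexpo (p i) =1 pure i (m %/ w i)) ->
  toric v ->
  v ord0 j ^+ m = \prod_i v ord0 (p i) ^+ (w i * wexpo j i).
Proof.
move=> pP tv; pose nu j' := (\sum_i w i * wexpo j i * (j' == p i))%N.
have := tv (fun j' => m * (j' == j))%N nu.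
rewrite (bigD1 j) //= eqxx muln1 big1 ?mulr1; last first.
  by move=> j' /negPf ->; rewrite muln0 expr0.
move=> -> => [|i].
  under eq_bigr => j' _ do rewrite -prodrXr.
  rewrite exchange_big; apply: eq_bigr => i _ /=.
  rewrite (bigD1 (p i)) //= eqxx muln1 big1 ?mulr1 // => j' /negPf ->.
  by rewrite muln0 expr0.
rewrite (bigD1 j) //= eqxx muln1 big1 ?addn0; last first.
  by move=> j' /negPf ->; rewrite muln0.
under eq_bigr => j' _ do rewrite big_distrl /=.
rewrite exchange_big /= (bigD1 i) //= [X in (_ + X)%N]big1 ?addn0.
  rewrite (bigD1 (p i)) //= eqxx muln1 big1 ?addn0; last first.
    by move=> j' /negPf ->; rewrite muln0.
  by rewrite pP /pure eqxx mulnAC [(w i * _)%N]mulnC divnK.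
move=> i' i'i; rewrite (bigD1 (p i')) //= big1 ?addn0; last first.
  by move=> j' /negPf ->; rewrite muln0.
by rewrite pP /pure eq_sym (negPf i'i) muln0.
Qed.

(** The nonzero coordinates of [v] define a character on the subgroup spanned by their exponents,
    well defined by the binomial equations; its extension to all exponents provides the nonzero
    entries of [y]. *)
Lemma toric_veronese v : toric v -> exists y, v = veronese w m y.
Proof.
move=> tv; have [p pP] := pure_index.
have v_neq0 j : (v ord0 j != 0) =
    [forall i, (wexpo j i != 0)%N ==> (v ord0 (p i) != 0)].
  have -> : (v ord0 j != 0) = (v ord0 j ^+ m != 0) by rewrite expf_eq0 m_gt0.
  rewrite (toric_pure _ pP tv); apply/prodf_neq0/forallP.
    move=> h i; apply/implyP => wi; have := h i isT; apply: contra_neq => ->.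
    by rewrite expr0n muln_eq0 (negPf wi) eqn0Ngt w_gt0.
  move=> h i _; have := h i; case: eqP => [->|_ /= vi]; last exact: expf_neq0.
  by rewrite muln0 expr0 oner_neq0.
(* Vanishing coordinates of [v] get a zero row here and the value 1 in [c], hence impose no
   condition. *)
pose A : 'M[int]_(N.+1, n) :=
  \matrix_(j, i) if v ord0 j != 0 then (wexpo j i)%:Z else 0.
pose c j := if v ord0 j != 0 then v ord0 j else 1.
have c0 j : c j != 0 by rewrite /c; case: ifP => //; rewrite oner_neq0.
have [mu muA|y y0 ey] := torus_pow_solve (A := A) c0.
  (* The positive and negative parts of a relation [mu] are the two exponents of one binomial
     equation. *)
  pose mup j := if v ord0 j != 0 then posz_part (mu ord0 j) else 0%N.
  pose mun j := if v ord0 j != 0 then negz_part (mu ord0 j) else 0%N.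
  have mu0 j : v ord0 j ^+ mun j != 0.
    by rewrite /mun; case: ifP => [|_]; [exact: expf_neq0|rewrite expr0 oner_neq0].
  have emu : forall j, c j ^ mu ord0 j = v ord0 j ^+ mup j / v ord0 j ^+ mun j.
    move=> j; rewrite /c /mup /mun; case: ifP => _; first exact: exprz_parts.
    by rewrite exp1rz expr0 divr1.
  rewrite (eq_bigr _ (fun j _ => emu j)) prodf_div (tv mup mun).
    by rewrite divff //; apply/prodf_neq0 => j _.
  move=> i; apply/eqP; rewrite -eqz_nat -subr_eq0; apply/eqP.
  have := congr1 (fun M : 'rV[int]_n => M ord0 i) muA; rewrite !mxE => <-.
  rewrite !(big_morph Posz PoszD (erefl 0%:Z)) -sumrB; apply: eq_bigr => j _.
  rewrite mxE /mup /mun; case: ifP => _; last by rewrite !mul0n mulr0 subrr.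
  by rewrite {3}(intz_parts (mu ord0 j)) !PoszM; ring.
(* The solution on the torus is set to 0 wherever the pure coordinate of [v] vanishes. *)
exists (fun i => if v ord0 (p i) != 0 then y i else 0).
apply/rowP => j; rewrite veroneseE /wmon.
have [vj0|] := eqVneq (v ord0 j) 0.
  have := v_neq0 j; rewrite vj0 eqxx /= => /esym /negbT.
  case/forallPn => i; rewrite negb_imply negbK => /andP[wi /eqP vi].
  by rewrite (bigD1 i) //= vi eqxx /= expr0n (negPf wi) mul0r.
move=> vj0; have := ey j; rewrite /c vj0 => <-; apply: eq_bigr => i _.
have := v_neq0 j; rewrite vj0 mxE vj0 => /esym /forallP /(_ i).
by have [->|_ /= ->//] := eqVneq (wexpo j i) 0%N; rewrite expr0 expr0z.
Qed.

Lemma veronese_toric y : toric (veronese w m y).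
Proof.
move=> mu nu e; rewrite -!wmon_veronese; exact: eq_wmon.
Qed.
Lemma zclosed_wps : zclosed (wps w m : set (projspace K N)).
Proof.
exists [set F | exists mu nu : 'I_N.+1 -> nat,
  (forall i, \sum_j mu j * wexpo j i = \sum_j nu j * wexpo j i)%N /\
  F = mpolyX K (Multinom [tuple mu j | j < N.+1]) -
      mpolyX K (Multinom [tuple nu j | j < N.+1])]; split.
  move=> F [mu [nu [e ->]]]; exists (\sum_j mu j)%N.
  have e' : (\sum_j mu j)%N = (\sum_j nu j)%N.
    by apply/eqP; rewrite -(eqn_pmul2r m_gt0) -!weight_comb (eq_weight _ e).
  apply: rpredB; first exact: (hpoly_mon erefl).
  by rewrite e'; exact: (hpoly_mon erefl).
apply/seteqP; split=> p /= => [pX F v|pP].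
  move=> [mu [nu [e ->]]] pv; have [y ->] := wps_hcoord pX pv.
  rewrite /rv_eval mevalB -![meval _ _]/(rv_eval _ _) !rv_eval_mon.
  by rewrite (veronese_toric _ e) subrr.
have [v pv] := hcoord_exists p.
have [mu nu e|y ey] := @toric_veronese v; last by exists y; rewrite -ey.
apply/eqP; rewrite -subr_eq0; apply/eqP.
have := pP _ v (ex_intro _ mu (ex_intro _ nu (conj e erefl))) pv.
by rewrite /rv_eval mevalB -![meval _ _]/(rv_eval _ _) !rv_eval_mon.
Qed.

Lemma wmon_scaled y y' (c : K) k alpha :
  veronese w m y' = c *: veronese w m y -> weight w alpha = (k * m)%N ->
  wmon y' alpha = c ^+ k * wmon y alpha.
Proof.
move=> e /weight_decomp[delta <- ed].
rewrite !(eq_wmon _ ed) !wmon_veronese e -prodrXr -big_split.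
by apply: eq_bigr => j _; rewrite mxE exprMn.
Qed.

(** The wanted [u] satisfies u^(w i) = y' i / y i on the common support of the two vectors.
    [torus_pow_solve] with one unknown yields it once every relation between the weights is shown to
    hold between these ratios. *)
Lemma veronese_fiber y y' (c : K) : c != 0 ->
  veronese w m y' = c *: veronese w m y ->
  exists2 u, u != 0 & forall i, y' i = u ^+ w i * y i.
Proof.
move=> c0 e.
have supp i : (y' i != 0) = (y i != 0).
  have mw : (0 < m %/ w i)%N by rewrite divn_gt0 // dvdn_leq.
  have ey : y' i ^+ (m %/ w i) = c * y i ^+ (m %/ w i).
    rewrite -!wmon_pure -[c]expr1; apply: wmon_scaled e _.
    by rewrite weight_pure mulnC divnK ?mul1n.
  have := congr1 (fun x => x != 0) ey.
  by rewrite mulf_eq0 (negPf c0) !expf_eq0 mw.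
pose A : 'M[int]_(n, 1) := \matrix_(i, _) if y i != 0 then (w i)%:Z else 0.
pose r i := if y i != 0 then y' i / y i else 1.
have r0 i : r i != 0.
  by rewrite /r; case: ifP => [yi|]; rewrite ?oner_neq0 // mulf_neq0 ?invr_eq0 ?supp.
have [mu muA|u u0 eu] := torus_pow_solve (A := A) r0; last first.
  exists (u ord0) => // i; have := eu i; rewrite /torus_pow big_ord1 mxE /r.
  case: ifPn => [yi|]; first by rewrite -exprnP => ->; rewrite divfK.
  rewrite negbK => /eqP yi _; have := supp i.
  by rewrite yi mulr0 eqxx => /negbFE/eqP.
pose mup i := if y i != 0 then posz_part (mu ord0 i) else 0%N.
pose mun i := if y i != 0 then negz_part (mu ord0 i) else 0%N.
have wmon_neq0 z alpha : (forall i, (z i != 0) = (y i != 0)) ->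
    (forall i, y i = 0 -> alpha i = 0%N) -> wmon z alpha != 0.
  move=> sz al; apply/prodf_neq0 => i _; have [yi|yi] := eqVneq (y i) 0.
    by rewrite al // expr0 oner_neq0.
  by rewrite expf_neq0 // sz.
have mup0 i : y i = 0 -> mup i = 0%N by rewrite /mup => ->; rewrite eqxx.
have mun0 i : y i = 0 -> mun i = 0%N by rewrite /mun => ->; rewrite eqxx.
have ew : weight w mup = weight w mun.
  apply/eqP; rewrite -eqz_nat -subr_eq0; apply/eqP.
  have := congr1 (fun M : 'rV[int]_1 => M ord0 ord0) muA; rewrite !mxE => <-.
  rewrite /weight !(big_morph Posz PoszD (erefl 0%:Z)) -sumrB.
  apply: eq_bigr => i _; rewrite mxE /mup /mun.
  case: ifP => _; last by rewrite !muln0 mulr0 subrr.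
  by rewrite {3}(intz_parts (mu ord0 i)) !PoszM; ring.
have er i : r i ^ mu ord0 i =
    (y' i ^+ mup i / y i ^+ mup i) / (y' i ^+ mun i / y i ^+ mun i).
  rewrite /r /mup /mun; case: ifP => _; last by rewrite exp1rz !expr0 !divr1.
  by rewrite exprz_parts !expr_div_n.
rewrite (eq_bigr _ (fun i _ => er i)) !prodf_div -!/(wmon _ _).
set k := weight w mup in ew.
(* The common weight k of [mup] and [mun] need not be a multiple of m, so the comparison uses two
   monomials of weight k m, whose quotient is that of the monomials [mup] and [mun]. *)
have e1 := @wmon_scaled y y' c k (fun i => mup i + m.-1 * mun i)%N e.
have e2 := @wmon_scaled y y' c k (fun i => m * mun i)%N e.
move: e1 e2; rewrite weightD !weightMn -ew -/k !wmonD !wmonMn => /(_ _)e1 /(_ _)e2.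
have {e1} := e1 _; have {e2} := e2 _; rewrite mulnC => /(_ erefl) e2.
rewrite -mulSn prednK // mulnC => /(_ erefl) e1.
have p'0 : wmon y' mup != 0 by exact: wmon_neq0.
have p0 : wmon y mup != 0 by exact: wmon_neq0.
have n'0 : wmon y' mun != 0 by exact: wmon_neq0.
have n0 : wmon y mun != 0 by exact: wmon_neq0.
move: e1 e2 p'0 p0 n'0 n0; rewrite -(prednK m_gt0) /= !exprS.
move: (wmon y' mup) (wmon y mup) (wmon y' mun) (wmon y mun) (c ^+ k) => P' P Q' Q ck.
move=> e1 e2 P'0 P0 Q'0 Q0.
have Q'm0 : Q' ^+ m.-1 != 0 by exact: expf_neq0.
have ePQ : P' * Q = P * Q'.
  by apply: (mulIf Q'm0); rewrite mulrAC e1 -[RHS]mulrA e2; ring.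
by rewrite invf_div mulf_div ePQ divff ?mulf_neq0.
Qed.

(** In characteristic 0 the first [size q] natural numbers are distinct, which is more than [q] has
    roots. *)
Lemma poly_nonroot (q : {poly K}) : q != 0 -> exists t, q.[t] != 0.
Proof.
move=> q0; apply: contrapT => /forallNP no.
have := max_poly_roots (rs := [seq (i%:R : K) | i <- iota 0 (size q)]) q0.
rewrite size_map size_iota ltnn map_inj_uniq ?iota_uniq; last first.
  exact: (mulrIn (oner_neq0 K)).
suff -> : all (root q) [seq (i%:R : K) | i <- iota 0 (size q)].
  by move=> /(_ isT isT).
by apply/allP => t _; rewrite /root; have /negP := no t; rewrite negbK.
Qed.

Lemma veronese_line (F : mpoly N.+1 K) y1 y2 : exists q : {poly K}, forall t,
  q.[t] = rv_eval F (veronese w m (fun i => y1 i + t * (y2 i - y1 i))).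
Proof.
exists (\sum_(a <- msupp F) (mcoeff a F)%:P * \prod_j (\prod_i
  ((y1 i)%:P + 'X * (y2 i - y1 i)%:P) ^+ wexpo j i) ^+ a j) => t.
rewrite /rv_eval mevalE horner_sum; apply: eq_bigr => a _.
rewrite hornerM hornerC horner_prod; congr (_ * _); apply: eq_bigr => j _.
rewrite horner_exp horner_prod veroneseE; congr (_ ^+ _); apply: eq_bigr => i _.
by rewrite horner_exp !hornerE.
Qed.

(** On the line through [y1] and [y2] both forms restrict to nonzero polynomials in one variable,
    whose product has a non-root. Irreducibility and density both rest on this. *)
Lemma veronese_common_neq0 (F G : mpoly N.+1 K) y1 y2 :
  rv_eval F (veronese w m y1) != 0 -> rv_eval G (veronese w m y2) != 0 ->
  exists y, rv_eval (F * G) (veronese w m y) != 0.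
Proof.
move=> F0 G0; have [q qE] := veronese_line F y1 y2.
have [r rE] := veronese_line G y1 y2.
have [|t] := @poly_nonroot (q * r).
  rewrite mulf_neq0 //; [apply: contra_neq F0 => q0|apply: contra_neq G0 => r0].
    have := qE 0; rewrite q0 horner0 => ->; congr (rv_eval _ (veronese _ _ _)).
    by apply/funext => i; rewrite mul0r addr0.
  have := rE 1; rewrite r0 horner0 => ->; congr (rv_eval _ (veronese _ _ _)).
  by apply/funext => i; rewrite mul1r addrC subrK.
rewrite hornerM qE rE => FG0; exists (fun i => y1 i + t * (y2 i - y1 i)).
by rewrite /rv_eval mevalM.
Qed.

Lemma wps_hcoord_ex y : (exists i, y i != 0) ->
  exists2 p, wps w m p & hcoord p (veronese w m y).
Proof.
move=> y0; have [|p pv] := @hcoord_ex _ _ (veronese w m y).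
  by rewrite veronese_neq0; apply/existsP.
by exists p => //; exists y.
Qed.

Lemma veronese_var i0 : exists2 F : mpoly N.+1 K, hpoly 1 F &
  forall y, (rv_eval F (veronese w m y) != 0) = (y i0 != 0).
Proof.
have [p pP] := pure_index; exists (mpolyX K (mnm1 (p i0))).
  by rewrite /hpoly dhomogX; apply/eqP; exact: mdeg1.
move=> y; rewrite /rv_eval mevalXU veroneseE (eq_wmon _ (pP _)) wmon_pure.
by rewrite expf_eq0 divn_gt0 // dvdn_leq.
Qed.

(** A form that is nonzero somewhere on the image is nonzero at some point where the coordinate [i0]
    is nonzero too. *)
Lemma wps_dense i0 (Z : set (projspace K N)) : zclosed Z ->
  (forall p y, hcoord p (veronese w m y) -> y i0 != 0 -> Z p) -> wps w m `<=` Z.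
Proof.
move=> [S [_ ->]] h p pX F v SF pv.
have [y1 ey] := wps_hcoord pX pv; rewrite ey.
apply: contrapT => /eqP F0; have [G _ G0] := veronese_var i0.
have [||y] := @veronese_common_neq0 F G y1 (fun=> 1); rewrite ?G0 ?oner_neq0 //.
rewrite /rv_eval mevalM mulf_eq0 negb_or -!/(rv_eval _ _) => /andP[Fy].
rewrite G0 => y0; have [|q _ qv] := @wps_hcoord_ex y; first by exists i0.
by move/eqP: Fy; apply; exact: (h _ _ qv y0 _ _ SF qv).
Qed.

Lemma zirreducible_wps : zirreducible (wps w m : set (projspace K N)).
Proof.
pose i0 := Ordinal n_gt0.
split.
  have [|p pX _] := @wps_hcoord_ex (fun=> 1); last by exists p.
  by exists i0; exact: oner_neq0.
move=> Z1 Z2 [S1 [_ ->]] [S2 [_ ->]] cov.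
apply: contrapT => /not_orP[]; rewrite /subset.
have nsub (S : set (mpoly N.+1 K)) :
    ~ (wps w m `<=` [set p | forall F v, S F -> hcoord p v -> rv_eval F v = 0]) ->
    exists2 F, S F & exists y, rv_eval F (veronese w m y) != 0.
  move=> h; apply: contrapT => no; apply: h => p pX F v SF pv.
  apply: contrapT => /eqP F0; apply: no; exists F => //.
  by have [y ey] := wps_hcoord pX pv; exists y; rewrite -ey.
move=> /nsub[F1 SF1 [y1 F1y]] /nsub[F2 SF2 [y2 F2y]].
have [y F12] := veronese_common_neq0 F1y F2y.
(* The extra factor [G] forces the vector found to be nonzero, so that it represents a point. *)
have [G _ G0] := veronese_var i0.
have [||z] := @veronese_common_neq0 (F1 * F2) G y (fun=> 1);
  rewrite ?G0 ?oner_neq0 //.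
rewrite /rv_eval !mevalM !mulf_eq0 !negb_or -!/(rv_eval _ _).
move=> /andP[/andP[/eqP F1z /eqP F2z]]; rewrite G0 => z0.
have [|q qX qv] := @wps_hcoord_ex z; first by exists i0.
by case: (cov q qX) => h; [apply: F1z|apply: F2z]; apply: h qv.
Qed.
End VeroneseTheory.

(** * Maps given by forms of the same degree *)

Section FormMaps.
Variable K : numClosedFieldType.

Lemma differentiable_bigsum (V W : normedModType K) (I : Type) (r : seq I)
    (f : I -> V -> W) (v : V) :
  (forall i, differentiable (f i) v) ->
  differentiable (fun x => \sum_(i <- r) f i x) v.
Proof.
move=> df; elim: r => [|i r IHr].
  by under eq_fun do rewrite big_nil; exact: differentiable_cst.
by under eq_fun do rewrite big_cons; exact: differentiableD.
Qed.

Lemma differentiable_bigprod (V : normedModType K) (I : Type) (r : seq I)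
    (f : I -> V -> K) (v : V) :
  (forall i, differentiable (f i) v) ->
  differentiable (fun x => \prod_(i <- r) f i x) v.
Proof.
move=> df; elim: r => [|i r IHr].
  by under eq_fun do rewrite big_nil; exact: differentiable_cst.
by under eq_fun do rewrite big_cons; exact: differentiableM.
Qed.

Lemma differentiable_rv_eval n (F : mpoly n.+1 K) (v : 'rV[K]_n.+1) :
  differentiable (rv_eval F) v.
Proof.
have -> : rv_eval F =
    fun x => \sum_(a <- msupp F) mcoeff a F * \prod_i x ord0 i ^+ a i.
  by apply/funext => x; exact: mevalE.
apply: differentiable_bigsum => a; apply: differentiableM.
  exact: differentiable_cst.
apply: differentiable_bigprod => i; elim: (a i) => [|k IHk].
  by under eq_fun do rewrite expr0; exact: differentiable_cst.
under eq_fun do rewrite exprS; apply: differentiableM => //.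
exact: differentiable_coord.
Qed.

Definition form_map N M (H : 'I_M -> mpoly N K) (v : 'rV[K]_N) : 'rV[K]_M :=
  \row_j rv_eval (H j) v.

Lemma differentiable_form_map N M (H : 'I_M.+1 -> mpoly N.+1 K) v :
  differentiable (form_map H) v.
Proof.
rewrite (_ : form_map H = fun v => \sum_j rv_eval (H j) v *: delta_mx ord0 j).
  apply: differentiable_bigsum => j; apply: differentiableZl.
  exact: differentiable_rv_eval.
apply/funext => x; rewrite [LHS]row_sum_delta; apply: eq_bigr => j _.
by rewrite mxE.
Qed.

Lemma rv_evalZ n k (F : mpoly n K) (c : K) v : hpoly k F ->
  rv_eval F (c *: v) = c ^+ k * rv_eval F v.
Proof.
move=> /dhomogP hF; rewrite /rv_eval !mevalE big_distrr /= !big_seq.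
apply: eq_bigr => a /hF; rewrite /= mdegE => <-.
rewrite mulrCA -prodrXr -big_split; congr (_ * _); apply: eq_bigr => i _.
by rewrite mxE exprMn.
Qed.

Lemma form_mapZ N M k (H : 'I_M -> mpoly N K) (c : K) v :
  (forall j, hpoly k (H j)) -> form_map H (c *: v) = c ^+ k *: form_map H v.
Proof. by move=> hH; apply/rowP => j; rewrite !mxE (rv_evalZ _ _ (hH j)). Qed.

Lemma hcoord_line N (p : projspace K N) v v' : hcoord p v -> hcoord p v' ->
  exists2 c, c != 0 & v' = c *: v.
Proof.
move=> [v0 vp] [v'0 v'p]; have /vlineP[c ec] : v' \in <[v]>%VS.
  suff -> : <[v]>%VS = val p by [].
  by apply/eqP; rewrite eqEdim -memvE vp dim_vline v0 (eqP (valP p)).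
by exists c => //; apply: contra_neq v'0 => c0; rewrite ec c0 scale0r.
Qed.

Lemma hcoordZ N (p : projspace K N) v c : c != 0 -> hcoord p v -> hcoord p (c *: v).
Proof.
by move=> c0 [v0 vp]; split; [rewrite scaler_eq0 negb_or c0 | exact: memvZ].
Qed.

(** The forms define one polynomial map between the spaces of homogeneous coordinates,
    differentiable everywhere; so analyticity holds at every point of [X], singular or not. *)
Lemma form_map_c_analytic N M k (X : set (projspace K N))
    (H : 'I_M.+1 -> mpoly N.+1 K) :
  (forall j, hpoly k (H j)) ->
  (forall p v, X p -> hcoord p v -> form_map H v != 0) ->
  exists2 F : projspace K N -> projspace K M, c_analytic X F &
    forall p v, X p -> hcoord p v -> hcoord (F p) (form_map H v).
Proof.
move=> hH H0.
have one0 : const_mx 1 != 0 :> 'rV[K]_M.+1.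
  by apply/eqP => /rowP /(_ ord0); rewrite !mxE => /eqP; rewrite oner_eq0.
have /choice[F FP] : forall p : projspace K N, exists q : projspace K M,
    forall v, hcoord p v -> form_map H v != 0 -> hcoord q (form_map H v).
  move=> p.
  have [v pv] := hcoord_exists p.
  (* Where all the forms vanish, which happens only off [X], the image is a default point. *)
  have [Hv0|Hv0] := eqVneq (form_map H v) 0.
    have [q _] := hcoord_ex one0; exists q => v' pv'.
    have [c _ ->] := hcoord_line pv pv'.
    by rewrite (form_mapZ _ _ hH) Hv0 scaler0 eqxx.
  have [q qv] := hcoord_ex Hv0; exists q => v' pv' _.
  have [c c0 ->] := hcoord_line pv pv'.
  by rewrite (form_mapZ _ _ hH); apply: hcoordZ qv; exact: expf_neq0.
have FX p v : X p -> hcoord p v -> hcoord (F p) (form_map H v).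
  by move=> pX pv; apply: FP => //; exact: H0 pX pv.
exists F => //; split; last first.
  move=> p pX _; have [v pv] := hcoord_exists p.
  exists setT, (form_map H); split=> //; first exact: openT.
  - by exists v.
  - by move=> u _; exact: differentiable_form_map.
  - by move=> q u qX _; exact: FX.
apply: continuous_in_subspaceT => p /set_mem pX B.
rewrite nbhsE => -[C [oC CFp] CB].
(* The cone over this neighbourhood is the preimage of the open cone over [C] under the continuous
   map [form_map H], within the nonzero vectors. *)
apply: (@filterS _ _ _ [set q | exists2 v, hcoord q v & hcone C (form_map H v)]).
  move=> q [v qv [r Cr rv]]; apply: CB; rewrite /= (_ : F q = r) //.
  by apply: (hcoord_inj _ rv); apply: FP => //; case: rv.
apply: open_nbhs_nbhs; split; last first.
  by have [v pv] := hcoord_exists p; exists v => //; exists (F p) => //; exact: FX.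
change (open (hcone [set q | exists2 v, hcoord q v & hcone C (form_map H v)])).
rewrite (_ : hcone _ = form_map H @^-1` (hcone C) `&` hcone setT).
  apply: openI; last exact: proj_openT.
  apply: open_comp => [v _|]; last exact: oC.
  exact/differentiable_continuous/differentiable_form_map.
apply/seteqP; split=> v /=.
  move=> [q [v' qv' [r Cr rv']] qv]; split; last by exists q.
  exists r => //.
  have [c c0 ->] := hcoord_line qv' qv.
  by rewrite (form_mapZ _ _ hH); apply: hcoordZ rv'; exact: expf_neq0.
by move=> [Cv [q _ qv]]; exists q => //; exists v.
Qed.

End FormMaps.

(** * Monic centered representatives of conjugacy classes *)

Section MonicCentered.
Variable K : numClosedFieldType.
Implicit Types (d : nat) (p : {poly K}).

Lemma coef_mc_poly d (a : 'I_d.-1 -> K) k :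
  (mc_poly a)`_k = (k == d)%:R + \sum_(i < d.-1 | k == i) a i.
Proof.
rewrite /mc_poly coefD coefXn coef_sum; congr (_ + _); rewrite [RHS]big_mkcond.
apply: eq_bigr => i _; rewrite coefZ coefXn; case: eqP => _.
  by rewrite mulr1.
by rewrite mulr0.
Qed.

Lemma mc_poly_top d (a : 'I_d.-1 -> K) : (mc_poly a)`_d = 1.
Proof.
rewrite coef_mc_poly eqxx big1 ?addr0 // => i /eqP e.
by have := ltn_ord i; lia.
Qed.

Lemma mc_poly_subtop d (a : 'I_d.-1 -> K) : (0 < d)%N -> (mc_poly a)`_d.-1 = 0.
Proof.
move=> d0; rewrite coef_mc_poly big1 ?addr0 => [|i /eqP e].
  by case: eqP => // e; lia.
by have := ltn_ord i; lia.
Qed.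

Lemma mc_poly_low d (a : 'I_d.-1 -> K) (i : 'I_d.-1) : (mc_poly a)`_i = a i.
Proof.
rewrite coef_mc_poly (big_pred1 i) => [|j]; last by rewrite eq_sym.
by case: eqP => [e|_]; [have := ltn_ord i; lia | rewrite add0r].
Qed.

Lemma mc_polyP d p : (0 < d)%N -> (size p <= d.+1)%N -> p`_d = 1 -> p`_d.-1 = 0 ->
  p = mc_poly (fun i : 'I_d.-1 => p`_i).
Proof.
move=> d0 sp pd pd1; apply/polyP => k.
have [kd|kd] := ltnP k d.-1; first by rewrite (mc_poly_low _ (Ordinal kd)).
have [->|kd1] := eqVneq k d; first by rewrite mc_poly_top.
have [->|kd2] := eqVneq k d.-1; first by rewrite mc_poly_subtop.
have dk : (d < k)%N by move/eqP: kd1; move/eqP: kd2; lia.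
by rewrite !nth_default // (leq_trans _ dk) // (eqP (size_mc_poly _)).
Qed.

Lemma comp_poly_wide d p q : (size p <= d)%N ->
  p \Po q = \sum_(i < d) p`_i *: q ^+ i.
Proof.
move=> sp; rewrite /comp_poly (@horner_coef_wide _ d) ?size_map_polyC //.
by apply: eq_bigr => i _; rewrite coef_map mul_polyC.
Qed.

Lemma size_affine_exp (u b : K) k : (size (affine u b ^+ k) <= k.+1)%N.
Proof.
have sA : (size (affine u b) <= 2)%N.
  rewrite (leq_trans (size_polyD _ _)) // geq_max (leq_trans (size_polyC_leq1 _)) //.
  by rewrite (leq_trans (size_scale_leq _ _)) // size_polyX.
rewrite (leq_trans (size_poly_exp_leq _ _)) // ltnS -[leqRHS]mul1n leq_mul2r.
by apply/orP; right; lia.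
Qed.

Lemma coef_affine_exp (u b : K) k :
  (affine u b ^+ k)`_k = u ^+ k /\
  (affine u b ^+ k)`_k.-1 = if k is k'.+1 then k%:R * u ^+ k' * b else 1.
Proof.
elim: k => [|k [IH1 IH2]]; first by rewrite expr0 coef1.
have E j : (affine u b ^+ k.+1)`_j =
    u * (if j is j'.+1 then (affine u b ^+ k)`_j' else 0) + b * (affine u b ^+ k)`_j.
  rewrite exprS mulrDl coefD -scalerAl coefZ coefXM mul_polyC coefZ.
  by case: j.
rewrite !E IH1; split.
  by rewrite [X in b * X]nth_default ?size_affine_exp // mulr0 addr0 exprS.
case: k IH1 IH2 {E} => [|k] IH1 IH2 /=.
  by rewrite mulr0 !mul1r expr0 add0r mulr1.
by rewrite IH2 exprS -[k.+2%:R]natr1; ring.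
Qed.

(** Only the two top terms of [p] contribute in degrees d and d - 1. *)
Lemma coef_comp_affine d p (u b : K) : (0 < d)%N -> (size p <= d.+1)%N ->
  (p \Po affine u b)`_d = p`_d * u ^+ d /\
  (p \Po affine u b)`_d.-1 = p`_d.-1 * u ^+ d.-1 + p`_d * (d%:R * u ^+ d.-1 * b).
Proof.
case: d => // d _ sp; rewrite (comp_poly_wide _ sp) !big_ord_recr /=.
rewrite !coefD !coefZ; have [-> ->] := coef_affine_exp u b d.+1.
have [-> _] := coef_affine_exp u b d.
have low k : (d <= k)%N -> (\sum_(i < d) p`_i *: affine u b ^+ i)`_k = 0.
  move=> dk; rewrite coef_sum big1 // => i _; rewrite coefZ.
  have -> : (affine u b ^+ i)`_k = 0; last by rewrite mulr0.
  rewrite nth_default // (leq_trans (size_affine_exp _ _ _)) //.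
  exact: leq_trans (ltn_ord i) dk.
rewrite !low //= !add0r; split=> //.
by rewrite [X in _ * X + _]nth_default ?size_affine_exp // mulr0 add0r.
Qed.

Lemma affine_compV (u b : K) : u != 0 ->
  affine u b \Po affine u^-1 (- (b / u)) = 'X.
Proof.
move=> u0; rewrite affine_comp mulfV // mulrN mulrC divfK // addNr.
exact: affine10.
Qed.

Lemma MP_mc_surj d (x : MP K d) : (1 < d)%N -> exists a, MP_mc a = x.
Proof.
move=> d1; have d0 : (0 < d)%N by lia.
set f := val (repr x); have sf : size f = d.+1 by exact/eqP/(valP (repr x)).
have l0 : f`_d != 0.
  by have := lead_coef_eq0 f; rewrite /lead_coef sf /= -size_poly_eq0 sf => ->.
(* Conjugation by z |-> u z + b multiplies the leading coefficient by u^(d-1), which fixes [u]; [b]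
   is the translation that cancels the coefficient of degree d - 1. *)
pose u := d.-1.-root (f`_d)^-1; pose b := - (f`_d.-1 / (d%:R * f`_d)).
have dm : (0 < d.-1)%N by lia.
have u0 : u != 0 by rewrite rootC_eq0 // invr_eq0.
have ud : u ^+ d.-1 = (f`_d)^-1 by exact: rootCK.
pose A := affine u^-1 (- (b / u)).
pose g := A \Po (f \Po affine u b).
have sA : size (affine u b) = 2.
  by rewrite /affine -mul_polyC size_MXaddC polyC_eq0 (negPf u0) size_polyC u0.
have gE : g = u^-1 *: (f \Po affine u b) + (- (b / u))%:P.
  rewrite /g /A [affine u^-1 _]/affine.
  by rewrite comp_polyD comp_polyZ comp_polyX comp_polyC.
have sg : (size g <= d.+1)%N.
  rewrite gE (leq_trans (size_polyD _ _)) // geq_max.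
  rewrite (leq_trans (size_scale_leq _ _)) ?size_comp_poly2 ?sf //.
  exact: leq_trans (size_polyC_leq1 _) _.
have [|top sub] := @coef_comp_affine d f u b d0; first by rewrite sf.
have ud' : u ^+ d = u * (f`_d)^-1 by rewrite -ud -exprS prednK.
have gd : g`_d = 1.
  rewrite gE coefD coefZ coefC top (gtn_eqF d0) ud' addr0.
  by field; rewrite u0 l0.
have gd1 : g`_d.-1 = 0.
  rewrite gE coefD coefZ coefC sub (gtn_eqF dm) ud addr0 /b.
  by field; rewrite u0 l0 pnatr_eq0 -lt0n d0.
exists (fun i => g`_i); rewrite -[RHS]reprK; apply/eqmodP/asboolP.
exists u, b; split=> //=; rewrite -(mc_polyP d0 sg gd gd1) /g comp_polyA.
by rewrite affine_compV // comp_polyX.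
Qed.

Lemma coef_comp_scale p (u : K) k : (p \Po affine u 0)`_k = p`_k * u ^+ k.
Proof.
rewrite /affine addr0 comp_polyE coef_sum.
under eq_bigr => i _ do rewrite exprZn !coefZ coefXn.
have [kp|pk] := ltnP k (size p).
  rewrite (bigD1 (Ordinal kp)) //= eqxx mulr1 big1 ?addr0 // => i ik.
  rewrite (_ : (k == i) = false) ?mulr0 //; apply: contra_neqF ik => /eqP e.
  exact: val_inj.
rewrite nth_default // mul0r big1 // => i _; have := ltn_ord i.
by case: eqP => [e|_]; [lia | rewrite !mulr0].
Qed.

(** In a conjugation by u z + b between monic centered polynomials, degree d gives u^d = u and
    degree d - 1 gives b = 0. The remaining coefficients satisfy u a_i = a'_i u^i, where u may be
    replaced by u^d. *)
Lemma MP_mc_eqP d (a a' : 'I_d.-1 -> K) : (1 < d)%N ->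
  MP_mc a = MP_mc a' <->
  exists2 u, u ^+ d.-1 = 1 & forall i, a' i = u ^+ (d - i) * a i.
Proof.
move=> d1; have d0 : (0 < d)%N by lia.
have dm : (0 < d.-1)%N by lia.
have affE (u b : K) p k :
    (affine u b \Po p)`_k = u * p`_k + (if k == 0%N then b else 0).
  rewrite /affine comp_polyD comp_polyZ comp_polyX comp_polyC.
  by rewrite coefD coefZ coefC.
split=> [/eqmodP/asboolP[u [b [u0 /= e]]]|[u u1 e]].
  have [|top sub] := @coef_comp_affine d (mc_poly a') u b d0.
    by rewrite (eqP (size_mc_poly _)).
  move: top sub; rewrite -e !affE (gtn_eqF d0) (gtn_eqF dm).
  rewrite !mc_poly_top !mc_poly_subtop // mulr1 mulr0 !addr0 mul0r !mul1r add0r.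
  move=> ud /esym/eqP; rewrite !mulf_eq0 pnatr_eq0 (gtn_eqF d0).
  rewrite expf_eq0 (negPf u0) andbF /=.
  move=> /eqP b0; exists u => [|i].
    by apply: (mulfI u0); rewrite -exprS prednK // mulr1.
  have := congr1 (fun p => p`_i) e; rewrite b0 affE coef_comp_scale if_same addr0.
  rewrite !mc_poly_low => ei; apply: (mulIf (expf_neq0 i u0)).
  rewrite -ei mulrAC -exprD subnK -?ud //.
  by have := ltn_ord i; lia.
have u0 : u != 0.
  by apply: contra_eq_neq u1 => ->; rewrite expr0n (gtn_eqF dm) eq_sym oner_neq0.
have ud : u ^+ d = u by rewrite -(prednK d0) exprS u1 mulr1.
apply/eqmodP/asboolP; exists u, 0; split=> //=.
apply/polyP => k; rewrite affE coef_comp_scale if_same addr0 !coef_mc_poly.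
have [->|kd] := eqVneq k d.
  rewrite !big1 ?addr0 ?mulr1 ?mul1r ?ud // => i /eqP ei; have := ltn_ord i; lia.
rewrite !add0r big_distrr big_distrl /=; apply: eq_bigr => i /eqP ->.
rewrite e mulrAC -exprD subnK ?ud //.
by have := ltn_ord i; lia.
Qed.

End MonicCentered.

(** * Roots of unity and their power sums *)

(** As n is invertible, X^n - 1 is separable and has n distinct roots; they form a cyclic group. *)
Lemma prim_root_exists (F : closedFieldType) n : n%:R != 0 :> F ->
  exists z : F, n.-primitive_root z.
Proof.
case: n => [|n] n0; first by rewrite eqxx in n0.
have [r] := closed_field_poly_normal ('X^(n.+1) - 1 : {poly F}).
rewrite (monicP (monicXnsubC 1 (ltn0Sn n))) scale1r => er.
have ur : uniq r.
  by rewrite -separable.separable_prod_XsubC -er cyclotomic.separable_Xn_sub_1.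
have sr : (n.+1 <= size r)%N.
  by rewrite -ltnS -(size_prod_XsubC r id) -er size_XnsubC.
have un : all n.+1.-unity_root r.
  by apply/allP => z; rewrite -root_prod_XsubC -er.
by have /hasP[z _ pz] := cyclic.has_prim_root (ltn0Sn n) un ur sr; exists z.
Qed.

Lemma sum_prim_root (R : idomainType) n (z : R) k : n.-primitive_root z ->
  \sum_(t < n) (z ^+ k) ^+ t = if (n %| k)%N then n%:R else 0.
Proof.
move=> pz; have zk1 : (z ^+ k == 1) = (n %| k)%N by rewrite -(prim_order_dvd pz).
case: ifP => [nk|nk].
  rewrite nk in zk1; rewrite (eqP zk1).
  under eq_bigr => t _ do rewrite expr1n.
  by rewrite sumr_const card_ord.
have := subrX1 (z ^+ k) n; rewrite -exprM mulnC exprM (prim_expr_order pz).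
rewrite expr1n subrr => /esym/eqP; rewrite mulf_eq0 subr_eq0 zk1 nk /=.
by move/eqP.
Qed.

(** * The compactification of the moduli space *)

Section Compactification.
Variables (K : numClosedFieldType).
Implicit Types d : nat.

(* The conjugation by z |-> u z multiplies the coefficient of z^i by u^(1-i);
   for a (d-1)-th root of unity this is u^(d-i).  Index ord0 is s, index
   lift ord0 i is a_i. *)
Definition mc_weight d : 'I_d.-1.+1 -> nat :=
  fun i => if unlift ord0 i is Some j then (d - j)%N else d.-1.

Definition mc_vec d (s : K) (a : 'I_d.-1 -> K) : 'I_d.-1.+1 -> K :=
  fun i => if unlift ord0 i is Some j then a j else s.

Definition mc_degree d := (d`! * d.-1.+1)%N.

Definition MPdim d := wdim (@mc_weight d) (mc_degree d).

Definition MPhat d : set (projspace K (MPdim d)) :=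
  wps (@mc_weight d) (mc_degree d).

Definition MP_veronese d (a : 'I_d.-1 -> K) : 'rV[K]_(MPdim d).+1 :=
  veronese (@mc_weight d) (mc_degree d) (mc_vec 1 a).

Lemma mc_weight0 d : mc_weight (ord0 : 'I_d.-1.+1) = d.-1.
Proof. by rewrite /mc_weight unlift_none. Qed.

Lemma mc_weightS d (j : 'I_d.-1) : mc_weight (lift ord0 j) = (d - j)%N.
Proof. by rewrite /mc_weight liftK. Qed.

Lemma mc_vec0 d s (a : 'I_d.-1 -> K) : mc_vec s a ord0 = s.
Proof. by rewrite /mc_vec unlift_none. Qed.

Lemma mc_vecS d s (a : 'I_d.-1 -> K) j : mc_vec s a (lift ord0 j) = a j.
Proof. by rewrite /mc_vec liftK. Qed.

Lemma mc_vec_eta d (y : 'I_d.-1.+1 -> K) :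
  mc_vec (d := d) (y ord0) (fun j : 'I_d.-1 => y (lift ord0 j)) = y.
Proof.
apply/funext => i; rewrite /mc_vec; case: unliftP => [j ->|->] //.
Qed.

Lemma mc_weight_gt0 d : (1 < d)%N -> forall i : 'I_d.-1.+1, (0 < mc_weight i)%N.
Proof.
move=> d1 i; rewrite /mc_weight; case: unliftP => [j _|_]; last by lia.
by have := ltn_ord j; lia.
Qed.

Lemma mc_weight_dvd d : (1 < d)%N -> forall i : 'I_d.-1.+1, (mc_weight i %| d`!)%N.
Proof.
move=> d1 i; apply: dvdn_fact; rewrite mc_weight_gt0 //=.
by rewrite /mc_weight; case: unliftP => [j _|_]; lia.
Qed.

Lemma proj_pt_subproof N : const_mx 1 != 0 :> 'rV[K]_N.+1.
Proof. by apply/eqP => /rowP /(_ ord0); rewrite !mxE => /eqP; rewrite oner_eq0. Qed.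

(** For d >= 2 the set is a single point, because [MP_veronese a] depends only on the class of [a].
    The first argument of [xget] is a default point. *)
Definition MPemb d (x : MP K d) : projspace K (MPdim d) :=
  xget (projT1 (cid (hcoord_ex (proj_pt_subproof (MPdim d)))))
    [set p | exists2 a, MP_mc a = x & hcoord p (MP_veronese a)].

Lemma mc_degree_dvd d i : (1 < d)%N -> (@mc_weight d i %| mc_degree d)%N.
Proof. by move=> d1; apply: dvdn_mulr; exact: mc_weight_dvd. Qed.

(** A (d-1)-th root of unity acts by a weighted rescaling that keeps s = 1. It multiplies the
    Veronese vector by its m-th power, which is 1 as d - 1 divides m. *)
Lemma MP_veronese_eq d (a a' : 'I_d.-1 -> K) : (1 < d)%N ->
  MP_mc a = MP_mc a' -> MP_veronese a = MP_veronese a'.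
Proof.
move=> d1 /(MP_mc_eqP _ _ d1)[u u1 e].
have -> : MP_veronese a' =
    veronese (@mc_weight d) (mc_degree d) (fun i => u ^+ mc_weight i * mc_vec 1 a i).
  congr veronese; apply/funext => i; rewrite /mc_vec /mc_weight.
  by case: unliftP => [j _|_]; rewrite ?e // u1 mulr1.
have um : u ^+ (d`! * d.-1.+1) = 1.
  have := mc_degree_dvd ord0 d1; rewrite mc_weight0 => /dvdnP[k].
  by rewrite /mc_degree mulnC => ->; rewrite mulnC exprM u1 expr1n.
rewrite veronese_scale ?fact_gt0 //; [|exact: mc_weight_gt0|exact: mc_weight_dvd].
by rewrite um scale1r.
Qed.

Lemma MPemb_hcoord d (a : 'I_d.-1 -> K) : (1 < d)%N ->
  hcoord (MPemb (MP_mc a)) (MP_veronese a).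
Proof.
move=> d1; rewrite /MPemb; case: xgetP => [p _ [a' e pa']|/(_ _) no].
  by rewrite (MP_veronese_eq d1 (esym e)).
have [|p] := @hcoord_ex _ _ (MP_veronese a); last first.
  by move=> pa; case: (no p); exists a.
rewrite /MP_veronese veronese_neq0 ?fact_gt0 //;
  [|exact: mc_weight_gt0|exact: mc_weight_dvd].
by apply/existsP; exists ord0; rewrite mc_vec0 oner_neq0.
Qed.

Lemma MPemb_veronese d (x : MP K d) : (1 < d)%N ->
  exists2 a, x = MP_mc a & hcoord (MPemb x) (MP_veronese a).
Proof.
by move=> d1; have [a <-] := MP_mc_surj x d1; exists a => //; exact: MPemb_hcoord.
Qed.

(** [veronese_fiber] gives a weighted rescaling between the two vectors; both have s = 1, so its
    factor is a (d-1)-th root of unity. *)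
Lemma MPemb_inj d : (1 < d)%N -> injective (@MPemb d).
Proof.
move=> d1 x x' exx'; have [a ex pa] := MPemb_veronese x d1.
have [a' ex' pa'] := MPemb_veronese x' d1.
rewrite ex ex'; rewrite exx' in pa; have [c c0 e] := hcoord_line pa pa'.
have [||||u u0 eu] := veronese_fiber _ _ _ _ c0 e; rewrite ?fact_gt0 //.
- exact: mc_weight_gt0.
- exact: mc_weight_dvd.
apply/(MP_mc_eqP _ _ d1); exists u => [|i].
  by have := eu ord0; rewrite !mc_vec0 mc_weight0 mulr1.
by have := eu (lift ord0 i); rewrite !mc_vecS mc_weightS.
Qed.

(** Rescaling by a (d-1)-th root of 1/s normalizes s to 1. *)
Lemma MPemb_chart d p (y : 'I_d.-1.+1 -> K) : (1 < d)%N ->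
  hcoord p (veronese (@mc_weight d) (mc_degree d) y) -> y ord0 != 0 ->
  range (@MPemb d) p.
Proof.
move=> d1 py y0; have dm : (0 < d.-1)%N by lia.
have w0 := mc_weight_gt0 d1; have wd := mc_weight_dvd d1.
pose u := d.-1.-root (y ord0)^-1.
have u0 : u != 0 by rewrite rootC_eq0 // invr_eq0.
pose z i := u ^+ mc_weight i * y i.
have z1 : z ord0 = 1 by rewrite /z mc_weight0 rootCK // mulVf.
exists (MP_mc (d := d) (fun j : 'I_d.-1 => z (lift ord0 j))) => //.
apply: hcoord_inj (MPemb_hcoord _ d1) _.
rewrite /MP_veronese -z1 (mc_vec_eta (d := d) z) veronese_scale ?fact_gt0 //.
by apply: hcoordZ => //; exact: expf_neq0.
Qed.

Lemma range_MPemb d : (1 < d)%N ->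
  exists Z, zclosed Z /\ range (@MPemb d) = MPhat (d := d) `\` Z.
Proof.
move=> d1; have w0 := mc_weight_gt0 d1; have wd := mc_weight_dvd d1.
have [F hF F0] := veronese_var K (ltn0Sn _) (fact_gt0 d) w0 wd ord0.
exists [set p | forall v, hcoord p v -> rv_eval F v = 0]; split.
  exists [set F]; split=> [_ ->|]; first by exists 1%N.
  by apply/seteqP; split=> p /= h; [move=> _ v ->; exact: h | move=> v; exact: h].
apply/seteqP; split=> p /=.
  move=> [x _ <-]; have [a -> pa] := MPemb_veronese x d1.
  split; first by exists (mc_vec 1 a).
  by move=> /(_ _ pa)/eqP; apply/negP; rewrite F0 mc_vec0 oner_neq0.
move=> [pX /existsNP[v /not_implyP[pv /eqP Fv]]].
have [||||y ey] := wps_hcoord _ _ _ _ pX pv; rewrite ?fact_gt0 //.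
by apply: (MPemb_chart (y := y)) => //; rewrite -?ey // -F0 -ey.
Qed.

Lemma MPhat_variety d : (1 < d)%N -> projective_variety (MPhat (d := d)).
Proof.
move=> d1; have w0 := mc_weight_gt0 d1; have wd := mc_weight_dvd d1.
by split; [apply: zclosed_wps|apply: zirreducible_wps]; rewrite ?fact_gt0.
Qed.

Lemma MPemb_dense d : (1 < d)%N -> zdense (range (@MPemb d)) (MPhat (d := d)).
Proof.
move=> d1; have w0 := mc_weight_gt0 d1; have wd := mc_weight_dvd d1.
move=> Z cZ sub.
apply: (wps_dense _ _ w0 wd (i0 := ord0)) => //; rewrite ?fact_gt0 // => p y py y0.
exact/sub/(MPemb_chart d1 py).
Qed.

Lemma pull_MP_veronese d (F : mpoly (MPdim d).+1 K) :
  exists p : mpoly d.-1 K, forall a, rv_eval F (MP_veronese a) = meval a p.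
Proof.
exists (\sum_(al <- msupp F) mcoeff al F *: \prod_j (\prod_i
  (if unlift ord0 i is Some k then mpolyX K (mnm1 k) else 1)
    ^+ wexpo (w := @mc_weight d) (m := mc_degree d) j i) ^+ al j) => a.
rewrite /rv_eval mevalE rmorph_sum; apply: eq_bigr => al _ /=.
rewrite mevalZ rmorph_prod; congr (_ * _); apply: eq_bigr => j _ /=.
rewrite rmorphXn rmorph_prod veroneseE; congr (_ ^+ _); apply: eq_bigr => i _ /=.
rewrite rmorphXn; congr (_ ^+ _); rewrite /mc_vec.
by case: unliftP => [k _|_]; rewrite /= ?mevalXU ?meval1.
Qed.

(* Averaging over the (d-1)-th roots of unity leaves the monomials of weight
   divisible by d - 1, which powers of s complete to weight k m. *)
Lemma MP_coord_fun_hpoly d (phi : MP K d -> K) : (1 < d)%N -> MP_coord_fun phi ->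
  exists k0, forall k, (k0 <= k)%N -> exists2 F : mpoly (MPdim d).+1 K,
    hpoly k F & forall a, rv_eval F (MP_veronese a) = phi (MP_mc a).
Proof.
move=> d1 [p pE]; have dm : (0 < d.-1)%N by lia.
have w0 := mc_weight_gt0 d1; have wd := mc_weight_dvd d1.
pose W (al : multinom d.-1) := (\sum_(i < d.-1) (d - i) * al i)%N.
exists (\max_(al <- msupp p) W al)%N => k k0k.
have Wk al : al \in msupp p -> (W al <= k * mc_degree d)%N.
  move=> alp; apply: leq_trans (leq_pmulr _ _); last by rewrite muln_gt0 fact_gt0.
  exact: leq_trans (leq_bigmax_seq _ alp isT) k0k.
(* The exponent of s; under the condition [C] below neither the subtraction nor the division
   truncates. *)
pose e al := ((k * mc_degree d - W al) %/ d.-1)%N.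
pose beta (al : multinom d.-1) : 'I_d.-1.+1 -> nat :=
  fun i => if unlift ord0 i is Some j then al j else e al.
pose C (al : multinom d.-1) := (d.-1 %| W al)%N && (W al <= k * mc_degree d)%N.
have dmd : (d.-1 %| mc_degree d)%N.
  by have := mc_degree_dvd ord0 d1; rewrite mc_weight0.
have wbeta al : C al -> weight (@mc_weight d) (beta al) = (k * mc_degree d)%N.
  move=> /andP[dW Wle]; rewrite /weight big_ord_recl mc_weight0 /beta unlift_none.
  have -> : (d.-1 * e al = k * mc_degree d - W al)%N.
    by rewrite mulnC divnK // dvdn_sub // dvdn_mull.
  rewrite -[RHS](subnK Wle); congr addn.
  by apply: eq_bigr => i _; rewrite mc_weightS liftK.
pose P y := \sum_(al <- msupp p | C al) mcoeff al p * wmon y (beta al).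
have wP : wform (@mc_weight d) (k * mc_degree d) P.
  by apply: wform_sum => al /wbeta <-; exact: WformMon.
have [||||F hF FE] := wform_hpoly _ _ _ _ wP erefl; rewrite ?fact_gt0 //.
exists F => // a; rewrite [LHS]FE pE /P.
have d1n0 : d.-1%:R != 0 :> K by rewrite pnatr_eq0 -lt0n.
have [z pz] := prim_root_exists d1n0.
have z1 t : (z ^+ t) ^+ d.-1 = 1.
  by rewrite -exprM mulnC exprM (prim_expr_order pz) expr1n.
have inv t : meval a p = meval (fun i => (z ^+ t) ^+ (d - i) * a i) p.
  by rewrite -!pE; congr phi; apply/(MP_mc_eqP _ _ d1); exists (z ^+ t).
(* After multiplication by d - 1 the right-hand side is a sum over the roots of unity, by the
   invariance [inv]. *)
apply: (mulfI d1n0).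
have -> : d.-1%:R * meval a p =
    \sum_(t < d.-1) meval (fun i => (z ^+ t) ^+ (d - i) * a i) p.
  under [RHS]eq_bigr => t _ do rewrite -inv.
  by rewrite sumr_const card_ord mulr_natl.
under [RHS]eq_bigr => t _ do rewrite mevalE.
rewrite [RHS]exchange_big /= big_distrr big_mkcond /= !big_seq.
apply: eq_bigr => al alp.
have -> : \sum_(t < d.-1) mcoeff al p *
      \prod_(i < d.-1) ((z ^+ t) ^+ (d - i) * a i) ^+ al i =
    mcoeff al p * (\prod_(i < d.-1) a i ^+ al i) * \sum_(t < d.-1) (z ^+ W al) ^+ t.
  rewrite big_distrr; apply: eq_bigr => t _ /=; rewrite -mulrA; congr (_ * _).
  under eq_bigr => i _ do rewrite exprMn.
  rewrite big_split mulrC /= exprAC; congr (_ * _).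
  rewrite /W -prodrXr; apply: eq_bigr => i _; by rewrite exprM.
rewrite sum_prim_root // /C Wk // andbT; case: ifP => _; last by rewrite mulr0.
rewrite mulrC; congr (_ * _ * _).
rewrite /wmon big_ord_recl mc_vec0 expr1n mul1r; apply: eq_bigr => i _.
by rewrite mc_vecS /beta liftK.
Qed.

Lemma rv_eval_MPemb d a v : (1 < d)%N -> hcoord (MPemb (MP_mc a)) v ->
  exists2 c : K, c != 0 & forall (F : mpoly (MPdim d).+1 K) k, hpoly k F ->
    rv_eval F v = c ^+ k * rv_eval F (MP_veronese a).
Proof.
move=> d1 pv; have [c c0 ->] := hcoord_line (MPemb_hcoord a d1) pv.
by exists c => // F k hF; exact: rv_evalZ.
Qed.

Lemma MP_pull d (F : mpoly (MPdim d).+1 K) : (1 < d)%N -> exists2 phi : MP K d -> K,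
  MP_coord_fun phi & forall a, phi (MP_mc a) = rv_eval F (MP_veronese a).
Proof.
move=> d1; have /choice[r rE] : forall x : MP K d, exists a, MP_mc a = x.
  by move=> x; exact: MP_mc_surj.
have E a : rv_eval F (MP_veronese (r (MP_mc a))) = rv_eval F (MP_veronese a).
  by rewrite (MP_veronese_eq d1 (rE _)).
exists (fun x => rv_eval F (MP_veronese (r x))) => //.
have [p pE] := pull_MP_veronese F; exists p => a; by rewrite E.
Qed.

(** [MP_coord_fun_hpoly] turns equations on MP_d into forms and [MP_pull] turns forms into
    equations; whether a form vanishes does not depend on the homogeneous coordinates chosen. *)
Lemma MP_closedP d (A : set (MP K d)) : (1 < d)%N ->
  MP_closed A <-> exists Z, zclosed Z /\ A = @MPemb d @^-1` Z.
Proof.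
move=> d1; split=> [[S [cS ->]]|[_ [[S [hS ->]] ->]]].
  pose S' (F : mpoly (MPdim d).+1 K) := exists phi k, [/\ S phi, hpoly k F &
    forall a, rv_eval F (MP_veronese a) = phi (MP_mc a)].
  exists [set p | forall F v, S' F -> hcoord p v -> rv_eval F v = 0]; split.
    by exists S'; split=> // F [phi [k [_ hF _]]]; exists k.
  apply/seteqP; split=> x /=; have [a -> pa] := MPemb_veronese x d1.
    move=> h F v [phi [k [Sphi hF FE]]] pv.
    have [c _ cE] := rv_eval_MPemb d1 pv; rewrite (cE _ _ hF).
    by rewrite FE h // mulr0.
  move=> h phi Sphi.
    have [k /(_ k (leqnn k))[F hF FE]] := MP_coord_fun_hpoly d1 (cS _ Sphi).
  by rewrite -FE; apply: (h _ _ _ pa); exists phi, k.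
exists [set phi | exists2 F, S F & MP_coord_fun phi /\
  forall a, phi (MP_mc a) = rv_eval F (MP_veronese a)]; split.
  by move=> phi [F _ []].
apply/seteqP; split=> x /=; have [a -> pa] := MPemb_veronese x d1.
  by move=> h phi [F SF [_ phiE]]; rewrite phiE; exact: h.
move=> h F v SF pv; have [k hF] := hS F SF.
have [c _ cE] := rv_eval_MPemb d1 pv; rewrite (cE _ _ hF).
have [phi cphi phiE] := MP_pull F d1; rewrite -phiE h ?mulr0 //.
by exists F.
Qed.

Lemma MP_regularP d (x : MP K d) (phi : projspace K (MPdim d) -> K) : (1 < d)%N ->
  regular_at (range (@MPemb d)) phi (MPemb x) <-> MP_regular_at (phi \o @MPemb d) x.
Proof.
move=> d1; have [a0 -> pa0] := MPemb_veronese x d1; split.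
  move=> [k [F [G [hF hG G0 E]]]].
  have [f cf fE] := MP_pull F d1; have [g cg gE] := MP_pull G d1.
  exists f, g; split=> //; first by rewrite gE; exact: G0.
  move=> x'; have [a -> pa] := MPemb_veronese x' d1; rewrite fE gE => Ga /=.
  by apply: E => //; exists (MP_mc a).
move=> [f [g [cf cg g0 E]]].
(* Numerator and denominator come from forms of every large degree, so a common degree can be
   taken. *)
have [kf Ff] := MP_coord_fun_hpoly d1 cf; have [kg Fg] := MP_coord_fun_hpoly d1 cg.
have [F hF FE] := Ff _ (leq_maxl kf kg); have [G hG GE] := Fg _ (leq_maxr kf kg).
exists (maxn kf kg), F, G; split=> //.
  move=> v pv; have [c c0 cE] := rv_eval_MPemb d1 pv; rewrite (cE _ _ hG).
  by rewrite mulf_neq0 ?expf_neq0 ?GE.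
move=> q v [x' _ <-]; have [a ex _] := MPemb_veronese x' d1; rewrite ex => pv.
have [c c0 cE] := rv_eval_MPemb d1 pv.
rewrite (cE _ _ hF) (cE _ _ hG) FE GE mulf_eq0 negb_or => /andP[ck0 ga].
by rewrite -[LHS]/((phi \o @MPemb d) (MP_mc a)) E // invfM mulrACA divff ?mul1r.
Qed.

Lemma MPhat_compactification d : (1 < d)%N ->
  projective_compactification (MPhat (d := d)) (@MPemb d).
Proof.
move=> d1; split; [exact: MPhat_variety| |exact: MPemb_dense].
split; [exact: MPemb_inj|exact: range_MPemb| |].
- by move=> A; exact: MP_closedP.
- by move=> x phi; exact: MP_regularP.
Qed.

End Compactification.

(** * Polynomials with weighted homogeneous coefficients *)

Section CoefficientForms.
Variables (K : numClosedFieldType) (n : nat) (w : 'I_n -> nat).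

(* Q is weighted homogeneous of degree e when the polynomial variable has
   weight 1. *)
Definition cforms e (Q : ('I_n -> K) -> {poly K}) := forall j,
  if (j <= e)%N then wform w (e - j) (fun y => (Q y)`_j) else forall y, (Q y)`_j = 0.

Lemma cformsD e P Q : cforms e P -> cforms e Q -> cforms e (fun y => P y + Q y).
Proof.
move=> hP hQ j; have := hP j; have := hQ j; case: ifP => _ hQj hPj.
  by apply: WformE (WformD hPj hQj) => y; rewrite coefD.
by move=> y; rewrite coefD hPj hQj addr0.
Qed.

Lemma cforms_sum (I : Type) (r : seq I) e (P : I -> ('I_n -> K) -> {poly K}) :
  (forall i, cforms e (P i)) -> cforms e (fun y => \sum_(i <- r) P i y).
Proof.
move=> hP; elim: r => [|i r IHr].
  move=> j; case: ifP => _; last by move=> y; rewrite big_nil coef0.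
  by apply: WformE (Wform0 _ _ _) => y; rewrite big_nil coef0.
by under eq_fun do rewrite big_cons; exact: cformsD.
Qed.

Lemma cformsM e e' P Q : cforms e P -> cforms e' Q ->
  cforms (e + e') (fun y => P y * Q y).
Proof.
move=> hP hQ j.
have term (i : 'I_j.+1) : if (j <= e + e')%N
    then wform w (e + e' - j) (fun y => (P y)`_i * (Q y)`_(j - i))
    else forall y, (P y)`_i * (Q y)`_(j - i) = 0.
  have := hP i; have := hQ (j - i)%N; have := ltn_ord i; rewrite ltnS => ij.
  case: (leqP i e) => [ie|ei] hQi hPi; last first.
    case: ifP => _; last by move=> y; rewrite hPi mul0r.
    by apply: WformE (Wform0 _ _ _) => y; rewrite hPi mul0r.
  move: hQi; case: leqP => [je|ej] hQi; last first.
    case: ifP => _; last by move=> y; rewrite hQi mulr0.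
    by apply: WformE (Wform0 _ _ _) => y; rewrite hQi mulr0.
  rewrite ifT; last by lia.
  by rewrite (_ : e + e' - j = (e - i) + (e' - (j - i)))%N; [exact: wformM|lia].
case: ifP term => _ term; last first.
  by move=> y; rewrite coefM big1 // => i _; exact: term.
apply: WformE (wform_sum (index_enum 'I_j.+1) (C := xpredT) (fun i _ => term i)) => y.
by rewrite coefM.
Qed.

Lemma cforms1 : cforms 0 (fun=> 1).
Proof.
move=> j; case: ifP => [|/negbT]; last first.
  by rewrite -ltnNge lt0n => j0 y; rewrite coef1 (negPf j0).
rewrite leqn0 => /eqP ->; apply: WformE (wform_cst w (1 : K)) => y.
by rewrite coef1.
Qed.

Lemma cformsX e P k : cforms e P -> cforms (k * e) (fun y => P y ^+ k).
Proof.
move=> hP; elim: k => [|k IHk].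
  by under eq_fun do rewrite expr0; exact: cforms1.
by under eq_fun do rewrite exprS; rewrite mulSn; exact: cformsM.
Qed.

Lemma cformsZ e e' c Q : wform w e c -> cforms e' Q ->
  cforms (e + e') (fun y => c y *: Q y).
Proof.
move=> hc hQ j; have := hQ j; case: leqP => [je|ej] hQj; last first.
  case: ifP => _; last by move=> y; rewrite coefZ hQj mulr0.
  by apply: WformE (Wform0 _ _ _) => y; rewrite coefZ hQj mulr0.
rewrite ifT; last by lia.
rewrite (_ : e + e' - j = e + (e' - j))%N; last by lia.
by apply: WformE (wformM hc hQj) => y; rewrite coefZ.
Qed.

End CoefficientForms.

(** * Products and powers of monic centered polynomials *)

Section CenteredMonic.
Variable K : fieldType.
Implicit Types p q : {poly K}.

(** In terms of degrees, p - X^e has degree at most e - 2: p is monic of degree e with no term of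
    degree e - 1. *)
Definition cmonic e p := (size (p - 'X^e)%R <= e.-1)%N.

Lemma cmonicM e e' p q : cmonic e p -> cmonic e' q -> cmonic (e + e') (p * q).
Proof.
rewrite /cmonic => hp hq; set r := p - _ in hp; set r' := q - _ in hq.
have -> : p * q - 'X^(e + e') = r' * 'X^e + r * 'X^e' + r * r'.
  by rewrite /r /r' exprD; ring.
have szM (f g : {poly K}) a b : (size f <= a.-1)%N -> (size g <= b.+1)%N ->
    (size (f * g)%R <= (a + b).-1)%N.
  move=> hf hg; have [->|f0] := eqVneq f 0; first by rewrite mul0r size_poly0.
  have : (0 < size f)%N by rewrite size_poly_gt0.
  by have := size_polyMleq f g; lia.
rewrite (leq_trans (size_polyD _ _)) // geq_max (leq_trans (size_polyD _ _)) ?geq_max.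
  by rewrite szM //; lia.
by rewrite addnC szM ?size_polyXn // addnC szM ?size_polyXn.
Qed.

Lemma cmonicX e p k : cmonic e p -> cmonic (k * e) (p ^+ k).
Proof.
move=> hp; elim: k => [|k IHk]; first by rewrite /cmonic !expr0 subrr size_poly0.
by rewrite exprS mulSn; exact: cmonicM.
Qed.

Lemma cmonic_coef e p : (0 < e)%N -> cmonic e p ->
  [/\ p`_e = 1, p`_e.-1 = 0 & (size p <= e.+1)%N].
Proof.
move=> e0; rewrite /cmonic -{2 3 4}[p](subrK 'X^e); move: (p - _) => r hp.
have r0 : r`_e = 0 by rewrite nth_default // (leq_trans hp) // leq_pred.
have r1 : r`_e.-1 = 0 by rewrite nth_default.
rewrite !coefD !coefXn eqxx r0 r1 !add0r; split=> //.
  by case: eqP => // ee; lia.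
rewrite (leq_trans (size_polyD _ _)) // size_polyXn geq_max leqnn andbT.
by rewrite (leq_trans hp); lia.
Qed.

End CenteredMonic.

(** * The homogenized iterate and the extension of iteration *)

Section Iteration.
Variables (K : numClosedFieldType) (d : nat).
Hypothesis d1 : (1 < d)%N.
Implicit Types (y : 'I_d.-1.+1 -> K).

Let d0 : (0 < d)%N. Proof. exact: ltnW. Qed.
Let dm : (0 < d.-1)%N. Proof. by lia. Qed.

(* The k-th iterate of z^d + sum a_i z^i, made weighted homogeneous of degree
   d^k: the term a_i g^i of f(g) falls short of it by (d^k - 1)(d - i), which
   is made up for by a power of s. *)
Fixpoint hiter (k : nat) y : {poly K} :=
  if k is k'.+1 then hiter k' y ^+ d + \sum_(i < d.-1)
    (y (lift ord0 i) * y ord0 ^+ ((d ^ k').-1 %/ d.-1 * (d - i))) *: hiter k' y ^+ i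
  else 'X.

Lemma hiterS k y : hiter k.+1 y = hiter k y ^+ d + \sum_(i < d.-1)
  (y (lift ord0 i) * y ord0 ^+ ((d ^ k).-1 %/ d.-1 * (d - i))) *: hiter k y ^+ i.
Proof. by []. Qed.

Let dvd_pred k : (d.-1 %| (d ^ k).-1)%N.
Proof. by rewrite predn_exp dvdn_mulr. Qed.

Lemma hiter_mc k a : hiter k (mc_vec 1 a) = poly_iter k (mc_poly a).
Proof.
rewrite /poly_iter; elim: k => [//|k IHk] /=; rewrite -IHk /mc_poly.
rewrite comp_polyD comp_Xn_poly raddf_sum; congr (_ + _); apply: eq_bigr => i _.
by rewrite /= comp_polyZ comp_Xn_poly mc_vec0 mc_vecS expr1n mulr1.
Qed.

Lemma cforms_hiter k : cforms (@mc_weight d) (d ^ k) (hiter k).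
Proof.
elim: k => [|k IHk] /=.
  case=> [|j]; first by apply: WformE (Wform0 _ _ _) => y; rewrite coefX.
  case: j => [|j]; first by apply: WformE (wform_cst _ (1 : K)) => y; rewrite coefX.
  by move=> y; rewrite coefX.
rewrite expnS; apply: cformsD; first exact: cformsX.
apply: cforms_sum => i.
(* The weights of a_i, of the power of s and of g^i add up: (d - i) + (d^k - 1)(d - i) + i d^k = d
   d^k. *)
rewrite (_ : d * d ^ k = mc_weight (lift ord0 i) +
    ((d ^ k).-1 %/ d.-1 * (d - i)) * mc_weight (ord0 : 'I_d.-1.+1) + i * d ^ k)%N.
  apply: cformsZ; last exact: cformsX.
  by apply: wformM; [exact: wform_var | exact/wformX/wform_var].
rewrite mc_weight0 mc_weightS mulnAC divnK //.
have : (0 < d ^ k)%N by rewrite expn_gt0 d0.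
have := ltn_ord i; case: (d ^ k)%N => // e; rewrite /= => id _.
rewrite -mulSn [(i * _)%N]mulnC -mulnDr mulnC; congr muln; lia.
Qed.

(** With g of degree d^k, g^d stays monic centered, and the terms in g^i with i <= d - 2 have degree
    at most (d - 2) d^k, too low to disturb the two top coefficients. *)
Lemma cmonic_hiter k y : cmonic (d ^ k) (hiter k y).
Proof.
elim: k => [|k IHk]; first by rewrite /cmonic /= expn0 expr1 subrr size_poly0.
have e0 : (0 < d ^ k)%N by rewrite expn_gt0 d0.
have [_ _ sh] := cmonic_coef e0 IHk.
rewrite /cmonic expnS [hiter _ _]/= addrAC (leq_trans (size_polyD _ _)) // geq_max.
rewrite [X in X && _](cmonicX d IHk) (leq_trans (size_sum _ _ _)) //.
apply/bigmax_leqP => i _; rewrite (leq_trans (size_scale_leq _ _)) //.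
rewrite (leq_trans (size_poly_exp_leq _ _)) //.
have := ltn_ord i; move: sh e0; move: (size _) (d ^ k)%N => s e se e0 id.
have : (s.-1 * i <= e * i)%N by rewrite leq_mul2r; apply/orP; right; lia.
have : (e * i.+2 <= e * d)%N by rewrite leq_mul2l; apply/orP; right; lia.
by rewrite !mulnS; lia.
Qed.

Lemma hiter_mc_poly k y :
  hiter k y = mc_poly (fun j : 'I_(d ^ k).-1 => (hiter k y)`_j).
Proof.
have e0 : (0 < d ^ k)%N by rewrite expn_gt0 d0.
by have [] := cmonic_coef e0 (cmonic_hiter k y); move=> h1 h2 sz; exact: mc_polyP.
Qed.

(** In the first step the exponent of s is 0, so f itself survives; in every later step it is
    positive, so only the d-th power remains. *)
Lemma hiter_s0 k y : y ord0 = 0 ->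
  hiter k.+1 y = mc_poly (fun i : 'I_d.-1 => y (lift ord0 i)) ^+ (d ^ k).
Proof.
move=> s0; elim: k => [|k IHk].
  rewrite expn0 expr1 /= /mc_poly; congr (_ + _); apply: eq_bigr => i _.
  by rewrite div0n mul0n expr0 mulr1.
rewrite hiterS IHk big1 => [|i _]; first by rewrite addr0 -exprM -expnSr.
rewrite s0 expr0n muln_eq0 eqn0Ngt divn_gt0 // subn_eq0.
rewrite (_ : (d.-1 <= (d ^ k.+1).-1)%N); last first.
  by rewrite predn_exp leq_pmulr // big_ord_recl expn0.
rewrite (_ : (d <= i)%N = false); last by have := ltn_ord i; lia.
by rewrite mulr0 scale0r.
Qed.

(** Weighted coordinates of the image point. The coordinate s of the target has weight d^n - 1,
    hence is this power of the source s, which has weight d - 1. *)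
Definition iter_vec n y : 'I_(d ^ n).-1.+1 -> K :=
  mc_vec (d := d ^ n) (y ord0 ^+ ((d ^ n).-1 %/ d.-1))
    (fun j : 'I_(d ^ n).-1 => (hiter n y)`_j).

Arguments iter_vec n y _ : clear implicits.

Lemma wform_iter_vec n (i : 'I_(d ^ n).-1.+1) :
  wform (@mc_weight d) (@mc_weight (d ^ n) i) (fun y => iter_vec n y i).
Proof.
rewrite /mc_weight /iter_vec /mc_vec; case: unliftP => [j _|_].
  have := cforms_hiter n j; rewrite ifT //.
  by have := ltn_ord j; lia.
have e : (d ^ n).-1 =
    ((d ^ n).-1 %/ d.-1 * mc_weight (ord0 : 'I_d.-1.+1))%N.
  by rewrite mc_weight0 divnK.
by rewrite [X in wform _ X _]e; exact/wformX/wform_var.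
Qed.

(** This excludes base points of the extension. If all coordinates vanish, then s = 0 and a power of
    f equals a power of X; so the monic f divides a power of X, is X^d, and all a_i are 0. *)
Lemma iter_vec_neq0 n y : (0 < n)%N ->
  (exists i, y i != 0) -> exists i, iter_vec n y i != 0.
Proof.
case: n => // n _ [i yi].
have [s0|s0] := eqVneq (y ord0) 0; last first.
  by exists ord0; rewrite /iter_vec mc_vec0 expf_neq0.
apply: contrapT => /forallNP no.
have h0 : hiter n.+1 y = 'X^(d ^ n.+1).
  rewrite hiter_mc_poly /mc_poly big1 ?addr0 // => j _.
  have /negP := no (lift ord0 j); rewrite /iter_vec mc_vecS negbK => /eqP ->.
  by rewrite scale0r.
set a := (fun j : 'I_d.-1 => y (lift ord0 j)).
have fdvd : mc_poly a %| ('X - 0%:P) ^+ (d ^ n.+1).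
  by rewrite subr0 -h0 hiter_s0 // dvdp_exp ?dvdpp // expn_gt0 d0.
have [k _] := dvdp_exp_XsubCP fdvd; rewrite subr0 => e.
have mf : mc_poly a \is monic.
  by rewrite monicE /lead_coef (eqP (size_mc_poly a)) mc_poly_top.
move: e; rewrite eqp_monic ?monicXn // => /eqP e.
have kd : k = d.
  by apply/eq_add_S; rewrite -(eqP (size_mc_poly a)) e size_polyXn.
move/negP: yi; apply.
case: (unliftP ord0 i) => [j ->|->]; last exact/eqP.
have := mc_poly_low a j; rewrite e kd coefXn /a => <-.
by rewrite ltn_eqF //; exact: leq_trans (ltn_ord j) (leq_pred d).
Qed.

(** The quotient is the common degree of the forms that define the extended map. *)
Lemma mc_degree_iter n : (0 < n)%N -> (mc_degree d %| mc_degree (d ^ n))%N.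
Proof.
move=> n0; have dD : (d <= d ^ n)%N by rewrite -{1}(expn1 d) leq_pexp2l.
have D0 : (0 < d ^ n)%N by rewrite expn_gt0 d0.
rewrite /mc_degree !prednK // dvdn_mul //; last by rewrite -{1}(expn1 d) dvdn_exp2l.
by rewrite -(ffact_fact (leq_subr d (d ^ n))) subKn // dvdn_mull.
Qed.

Lemma MP_iter_mc n (a : 'I_d.-1 -> K) :
  MP_iter n (MP_mc a) = MP_mc (fun j : 'I_(d ^ n).-1 => (hiter n (mc_vec 1 a))`_j).
Proof.
rewrite /MP_mc MP_iterE; congr (\pi_(_) _)%qT; apply: val_inj => /=.
by rewrite -hiter_mc_poly hiter_mc.
Qed.

Lemma MP_iter_extends n : (0 < n)%N ->
  exists F : projspace K (MPdim d) -> projspace K (MPdim (d ^ n)),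
    [/\ forall p, MPhat p -> MPhat (F p), c_analytic (MPhat (d := d)) F &
        forall x : MP K d, F (MPemb x) = MPemb (MP_iter n x)].
Proof.
move=> n0; have D1 : (1 < d ^ n)%N.
  by rewrite (leq_trans d1) // -{1}(expn1 d) leq_pexp2l.
have w0 := mc_weight_gt0 d1; have wd := mc_weight_dvd d1.
have W0 := mc_weight_gt0 D1; have WD := mc_weight_dvd D1.
have [k ek] := dvdnP (mc_degree_iter n0).
(* A target Veronese monomial evaluated at [iter_vec n y] is a weighted form in [y] of weight k
   times [mc_degree d], hence a form of degree k in the source Veronese coordinates. *)
have [|H /all_and2[hH HE]] := @fin_all_exists _
  (fun=> mpoly (MPdim d).+1 K) (fun (j : 'I_(MPdim (d ^ n)).+1) F => hpoly k F /\
   forall y, rv_eval F (veronese (@mc_weight d) (mc_degree d) y) =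
    wmon (iter_vec n y) (wexpo (w := @mc_weight (d ^ n)) (m := mc_degree (d ^ n)) j)).
  move=> j; pose g := wexpo (w := @mc_weight (d ^ n)) (m := mc_degree (d ^ n)) j.
  have wP : wform (@mc_weight d) (weight (@mc_weight (d ^ n)) g)
      (fun y => wmon (iter_vec n y) g).
    rewrite /weight; under eq_bigr => i _ do rewrite mulnC.
    by apply: wform_prod => i; apply: wformX; exact: wform_iter_vec.
  have [|||||F hF FE] := @wform_hpoly K _ (@mc_weight d) d`! _ _ _ _ _ _ k wP;
    rewrite ?fact_gt0 //; last by exists F.
  by rewrite wexpo_weight ?fact_gt0.
have HV y : form_map H (veronese (@mc_weight d) (mc_degree d) y) =
    veronese (@mc_weight (d ^ n)) (mc_degree (d ^ n)) (iter_vec n y).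
  by apply/rowP => j; rewrite !mxE HE.
have [|F cF FE] := @form_map_c_analytic K _ _ k (MPhat (d := d)) H hH.
  move=> p v pX pv; have [||||y ey] := wps_hcoord _ _ _ _ pX pv; rewrite ?fact_gt0 //.
  rewrite ey HV veronese_neq0 ?fact_gt0 //; apply/existsP.
  apply: iter_vec_neq0 => //.
  by have [+ _] := pv; rewrite ey veronese_neq0 ?fact_gt0 // => /existsP.
exists F; split=> // [p pX|x].
  by have [y py] := pX; exists (iter_vec n y); rewrite -HV; exact: FE.
have [a -> pa] := MPemb_veronese x d1.
apply: hcoord_inj (FE _ _ _ pa) _; first by exists (mc_vec 1 a).
rewrite MP_iter_mc /MP_veronese HV /iter_vec mc_vec0 expr1n.
exact: MPemb_hcoord.
Qed.

End Iteration.

Theorem corollary1p3 (R : realType) :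
  exists (N : nat -> nat)
         (MPhat : forall d : nat, set (projspace R[i] (N d)))
         (iota : forall d : nat, MP R[i] d -> projspace R[i] (N d)),
    (forall d : nat, (2 <= d)%N ->
       projective_compactification (MPhat d) (iota d)) /\
    (forall d n : nat, (2 <= d)%N -> (2 <= n)%N ->
       exists F : projspace R[i] (N d) -> projspace R[i] (N (d ^ n)%N),
         [/\ forall p, MPhat d p -> MPhat (d ^ n)%N (F p),
             c_analytic (MPhat d) F &
             forall m : MP R[i] d,
               F (iota d m) = iota (d ^ n)%N (MP_iter n m)]).
Proof.
exists MPdim, (fun d => MPhat (K := R[i]) (d := d)), (fun d => @MPemb R[i] d).
split=> [d d1|d n d1 n1]; first exact: MPhat_compactification.
exact: MP_iter_extends (ltnW n1).
Qed.
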